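(* Let $\varphi:\mathbb P^1\to\mathbb P^1$ be a branched Galois covering of degree $d$ with covering group $G\subset SO(3)$, and let $G^*\subset SU(2)$ be the binary group associated to $G$. (1) Let $F:\mathbb P^1\to\mathcal V_5$ be a sextic curve with a rational Galois lift $g:\mathbb P^1\to\mathbb P^3$ of degree $n$ satisfying $f_1\circ g=F\circ\varphi$. Then under the natural action of $G^*$, the lines spanned by the row vectors of $g$ correspond to a pair of isomorphic yet mutually independent $1$-dimensional irreducible representations of $G^*$ within $V_n\otimes\mathbb C^2$. (2) Conversely, let $kW$ ($k\ge2$) denote the direct sum of $k$ $1$-dimensional irreducible representations of $G^*$ within $V_n\otimes\mathbb C^2$, each isomorphic to the representation $W$. Then any two independent vectors in $kW$ (taken as the rows of $g$) induce a unique curve $F:\mathbb P^1\to\mathbb P^6$ satisfying $f_1\circ g=F\circ\varphi$.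
   Context: The ground field is $\mathbb C$. $V_n$ is the space of binary forms of degree $n$ (in variables $u,v$, or $x,y$), with $SL_2=SL_2(\mathbb C)$ acting by $(A\cdot f)(u,v)=f(A^{-1}(u,v)^T)$. $\mathcal V_5\subset\mathbb P(V_6)=\mathbb P^6$ is the closure of $PSL_2\cdot[uv(u^4-v^4)]$; it is the disjoint union of this open orbit, the orbit $PSL_2\cdot[u^5v]$ and the orbit $PSL_2\cdot[u^6]$. A sextic curve is a holomorphic curve $F:\mathbb P^1\to\mathcal V_5\subset\mathbb P^6$ of degree $6$, linearly full in $\mathbb P^6$, not contained in $\overline{PSL_2\cdot[u^5v]}$. Points of $\mathbb P^3$ are nonzero $2\times2$ matrices $\begin{pmatrix}a&b\\c&d\end{pmatrix}$ up to scale, and $f_1:\mathbb P^3\dashrightarrow\mathbb P(V_6)$ sends this matrix to $[(du-bv)(av-cu)((du-bv)^4-(av-cu)^4)]$; on $PSL_2$ it is the orbit map of $[uv(u^4-v^4)]$. $S_4^*\subset SU(2)$ is the binary octahedral group of order $48$ generated by $\mathrm{diag}(e^{\pi i/4},e^{-\pi i/4})$ and $\frac1{\sqrt2}\begin{pmatrix}1&-1\\1&1\end{pmatrix}$; its image in $PSL_2$ is the stabilizer of $[uv(u^4-v^4)]$. A branched covering $\varphi$ is Galois if its covering group $G=\{\sigma:\varphi\circ\sigma=\varphi\}$ has order $\deg\varphi$; the binary group $G^*$ is the preimage of $G$ under the double cover $SU(2)\to SO(3)$. A map $g:\mathbb P^1\to\mathbb P^3$ of degree $n$ is written $g([x,y])=\begin{pmatrix}a&b\\c&d\end{pmatrix}$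 with $a,b,c,d\in V_n$ (forms in $x,y$) without common factor. It is a rational Galois lift of $F$ if $f_1\circ g=F\circ\varphi$ and the homomorphism $\sigma\mapsto g(\sigma(q))^{-1}g(q)$ (independent of generic $q$) from $G$ to the stabilizer of $[uv(u^4-v^4)]$ is injective. The natural action of $G^*$ on $V_n\otimes\mathbb C^2$, whose elements $p\otimes e_1+q\otimes e_2$ are written as rows $(p,q)$, is $t\cdot(p,q)=(\phi_1(t)\cdot p,\phi_1(t)\cdot q)\,\phi_2(t)^T$, where $\phi_1:G^*\to SU(2)$ is the injective homomorphism covering the action of $G$ on the source $\mathbb P^1$ by covering transformations of $\varphi$, and $\phi_2:G^*\to S_4^*\subset SU(2)$ is an injective homomorphism (in (1), the one determined by the lift $g$; in (2), any given one). The row vectors of $g$ are $(a,b)$ and $(c,d)$.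
   Formalization: Part (2) additionally assumes that f_1∘g is not identically undefined; without this, e.g. φ=id, n=1 and rows (x,0),(y,0) give f_1∘g≡0, so no curve F is determined. In (1), φ_2 is taken to lift the contragredient of σ↦g(σ(q))^{-1}g(q), as the stated action requires. *)

(* Defs.v *)
From HB Require Import structures.
From mathcomp Require Import all_boot all_order all_algebra.
From mathcomp Require Import spectral.
From mathcomp Require Export reals complex mpoly.

Set Implicit Arguments.
Unset Strict Implicit.
Unset Printing Implicit Defensive.

Import Order.TTheory GRing.Theory Num.Theory.
Local Open Scope ring_scope.
Local Open Scope complex_scope.

(* A point of a projective space is a nonzero vector; proj_eq is equality of
   the points represented by two vectors. *)
Definition proj_eq (K : fieldType) (V : lmodType K) (v w : V) : Prop :=
  [/\ v != 0, w != 0 & exists c : K, v = c *: w].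

(* Left representations of a group S of matrices, given by functions rho that
   are only relevant on S, and their subrepresentations {vspace V}. *)
Section Representations.
Variables (K : fieldType) (m : nat) (S : 'M[K]_m -> Prop).

Definition is_rep (V : vectType K) (rho : 'M[K]_m -> V -> V) : Prop :=
  [/\ forall t, S t -> linear (rho t),
      rho 1%:M =1 id
    & forall s t, S s -> S t -> rho (s *m t) =1 rho s \o rho t].

Definition subrep (V : vectType K) (rho : 'M[K]_m -> V -> V)
    (U : {vspace V}) : Prop :=
  forall t, S t -> forall w, w \in U -> rho t w \in U.

Definition irreducible_rep (V : vectType K) (rho : 'M[K]_m -> V -> V)
    (U : {vspace V}) : Prop :=
  [/\ subrep rho U, U != 0%VS
    & forall U' : {vspace V},
        (U' <= U)%VS -> subrep rho U' -> U' = 0%VS \/ U' = U].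

Definition one_dim_irrep (V : vectType K) (rho : 'M[K]_m -> V -> V)
    (U : {vspace V}) : Prop :=
  \dim U = 1%N /\ irreducible_rep rho U.

Definition rep_iso (V1 V2 : vectType K)
    (rho1 : 'M[K]_m -> V1 -> V1) (U1 : {vspace V1})
    (rho2 : 'M[K]_m -> V2 -> V2) (U2 : {vspace V2}) : Prop :=
  exists f : 'Hom(V1, V2),
    [/\ {in U1 &, injective f}, (f @: U1)%VS = U2
      & forall t, S t -> {in U1, forall w, f (rho1 t w) = rho2 t (f w)}].

Definition inj_hom (T : 'M[K]_m -> Prop) (f : 'M[K]_m -> 'M[K]_m) : Prop :=
  [/\ forall s, S s -> T (f s),
      forall s t, S s -> S t -> f (s *m t) = f s *m f t
    & forall s t, S s -> S t -> f s = f t -> s = t].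

End Representations.

(* The space V_n of binary forms; 'X_0 and 'X_1 play the roles of u, v in the
   target space V_6, and of x, y in the source P^1. *)
Notation binform R n := (dhomog 2 R[i] n).

Section BinaryForms.
Variable R : realType.
Local Notation C := R[i].

Definition evalf (n : nat) (f : binform R n) (q : 'cV[C]_2) : C :=
  (f : {mpoly C[2]}).@[fun i => q i ord0].

Lemma lin_subst_homog (B : 'M[C]_2) n (f : binform R n) :
  ((f : {mpoly C[2]}) \mPo [tuple \sum_(j < 2) B i j *: 'X_j | i < 2])
    \is n.-homog.
Proof.
rewrite comp_mpolyE big_seq rpred_sum // => m mf; apply: rpredZ.
have <- : (\sum_(i < 2) m i)%N = n.
  by rewrite -mdegE; apply: (dhomog_mf (dhomog_is_dhomog f)).
elim/big_rec2: _ => [|i k p _ hp]; first exact: dhomog1.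
apply: dhomogM => //; rewrite -[X in X.-homog]mul1n.
apply: (@dhomogMn _ _ mdeg 1); rewrite tnth_mktuple rpred_sum // => j _.
by apply: rpredZ; rewrite dhomogX; apply/eqP; exact: mdeg1.
Qed.

(* f (B (x, y)^T) *)
Definition lin_subst (B : 'M[C]_2) n (f : binform R n) : binform R n :=
  DHomog (lin_subst_homog B f).

Definition act_form (A : 'M[C]_2) n (f : binform R n) : binform R n :=
  lin_subst (invmx A) f.

(* V_n (x) C^2, with p (x) e_1 + q (x) e_2 represented by the row (p, q). *)
Definition natural_act (phi1 phi2 : 'M[C]_2 -> 'M[C]_2) n (t : 'M[C]_2)
    (w : binform R n * binform R n) : binform R n * binform R n :=
  let p := act_form (phi1 t) w.1 in
  let q := act_form (phi1 t) w.2 in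
  let M := (phi2 t)^T in
  (M 0 0 *: p + M 1 0 *: q, M 0 1 *: p + M 1 1 *: q).

(* Maps from P^1 to a projective space. By Chow's theorem, the holomorphic ones
   of degree m are the maps q |-> mx_eval F q, where the entries of F are forms
   of degree m without common factor. *)
Definition mx_eval k l n (F : 'M[binform R n]_(k, l)) (q : 'cV[C]_2) :
  'M[C]_(k, l) := map_mx (fun f => evalf f q) F.

Definition no_common_factor k l n (F : 'M[binform R n]_(k, l)) : Prop :=
  forall h : {mpoly C[2]},
    (forall i j, exists p : {mpoly C[2]}, (F i j : {mpoly C[2]}) = h * p) ->
    exists c : C, h = c%:MP.

Definition linearly_full k n (F : 'cV[binform R n]_k) : Prop :=
  forall l : 'rV[C]_k, (forall q, l *m mx_eval F q = 0) -> l = 0.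

(* Coordinates on P(V_n) = P^n: the coefficients of u^(n-i) v^i. *)
Definition coords n (f : binform R n) : 'cV[C]_n.+1 :=
  \col_(i < n.+1)
    (f : {mpoly C[2]})@_[multinom [tuple (n - i)%N; i : nat]].

Lemma var_homog (i : 'I_2) : ('X_i : {mpoly C[2]}) \is 1.-homog.
Proof. by rewrite dhomogX; apply/eqP; exact: mdeg1. Qed.

Definition var (i : 'I_2) : binform R 1 := DHomog (var_homog i).

Lemma octa_homog (l1 l2 : binform R 1) :
  ((l1 : {mpoly C[2]}) * l2 * ((l1 : {mpoly C[2]}) ^+ 4 -
     (l2 : {mpoly C[2]}) ^+ 4)) \is 6.-homog.
Proof.
have h (l : binform R 1) : ((l : {mpoly C[2]}) ^+ 4) \is 4.-homog.
  exact: (dhomogMn 4 (dhomog_is_dhomog l)).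
apply: (@dhomogM _ _ mdeg 2 _ 4); last by apply: rpredB; apply: h.
by apply: (@dhomogM _ _ mdeg 1 _ 1); apply: dhomog_is_dhomog.
Qed.

(* l1 l2 (l1^4 - l2^4) *)
Definition octa (l1 l2 : binform R 1) : binform R 6 := DHomog (octa_homog l1 l2).

Lemma u5v_homog :
  (('X_0 : {mpoly C[2]}) ^+ 5 * ('X_1 : {mpoly C[2]})) \is 6.-homog.
Proof.
apply: (@dhomogM _ _ mdeg 5 _ 1); last exact: var_homog.
exact: (dhomogMn 5 (var_homog 0)).
Qed.

Definition u5v : binform R 6 := DHomog u5v_homog.

Definition f1 (M : 'M[C]_2) : binform R 6 :=
  octa (M 1 1 *: var 0 - M 0 1 *: var 1) (M 0 0 *: var 1 - M 1 0 *: var 0).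

(* Points of P^6 in the Zariski closure of PSL_2 . [h]; it agrees with the
   closure in the Euclidean topology, since orbits are constructible. *)
Definition in_orbit_closure (h : binform R 6) (w : 'cV[C]_7) : Prop :=
  w != 0 /\
  forall e (P : dhomog 7 C e),
    (forall A : 'M[C]_2, \det A = 1 ->
       (P : {mpoly C[7]}).@[fun i => coords (act_form A h) i 0] = 0) ->
    (P : {mpoly C[7]}).@[fun i => w i 0] = 0.

Definition in_V5 : 'cV[C]_7 -> Prop := in_orbit_closure (octa (var 0) (var 1)).

Definition sextic_curve (F : 'cV[binform R 6]_7) : Prop :=
  [/\ no_common_factor F,
      forall q, q != 0 -> in_V5 (mx_eval F q),
      linearly_full F
    & exists2 q, q != 0 & ~ in_orbit_closure u5v (mx_eval F q)].

Definition SU2 (A : 'M[C]_2) : Prop := A \is unitarymx /\ \det A = 1.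

(* The binary octahedral group; e^(pi i / 4) = (1 + i) / sqrt 2. *)
Definition octa_gen1 : 'M[C]_2 :=
  let z : C := (Num.sqrt 2%:R)^-1 +i* (Num.sqrt 2%:R)^-1 in
  \matrix_(i, j) (if i != j then 0 else if i == 0 then z else z^*).

Definition octa_gen2 : 'M[C]_2 :=
  ((Num.sqrt 2%:R)^-1 : R)%:C *:
    \matrix_(i, j) (if (i == 0) && (j == 1) then -1 else 1).

Inductive S4star : 'M[C]_2 -> Prop :=
  | S4star_gen1 : S4star octa_gen1
  | S4star_gen2 : S4star octa_gen2
  | S4star_1 : S4star 1%:M
  | S4star_mul A B : S4star A -> S4star B -> S4star (A *m B)
  | S4star_inv A : S4star A -> S4star (invmx A).

(* Automorphisms of P^1 are represented by invertible matrices, up to scale. *)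
Definition covering_transf d (phi : 'cV[binform R d]_2) (A : 'M[C]_2) : Prop :=
  A \in unitmx /\
  forall q, q != 0 -> proj_eq (mx_eval phi (A *m q)) (mx_eval phi q).

Definition galois_covering d (phi : 'cV[binform R d]_2) : Prop :=
  [/\ (0 < d)%N, no_common_factor phi
    & exists s : 'I_d -> 'M[C]_2,
      [/\ forall k, covering_transf phi (s k),
          forall k l, proj_eq (s k) (s l) -> k = l
        & forall A, covering_transf phi A -> exists k, proj_eq A (s k)]].

(* The covering group lies in PSU(2) = SO(3). *)
Definition covering_group_in_SO3 d (phi : 'cV[binform R d]_2) : Prop :=
  forall A, covering_transf phi A -> exists2 B, SU2 B & proj_eq A B.

Definition binary_group d (phi : 'cV[binform R d]_2) (t : 'M[C]_2) : Prop :=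
  SU2 t /\ covering_transf phi t.

(* phi1 : G^* -> SU(2) induces the tautological action of G on P^1. *)
Definition covers_action d (phi : 'cV[binform R d]_2)
    (phi1 : 'M[C]_2 -> 'M[C]_2) : Prop :=
  inj_hom (binary_group phi) SU2 phi1 /\
  forall t, binary_group phi t -> proj_eq (phi1 t) t.

(* Equality of the rational maps f_1 o g and F o phi: f_1 o g is defined at
   some point, and both maps agree wherever it is. *)
Definition f1_lift d n m (phi : 'cV[binform R d]_2) (g : 'M[binform R n]_2)
    (F : 'cV[binform R m]_7) : Prop :=
  (exists2 q, q != 0 & f1 (mx_eval g q) != 0) /\
  forall q, q != 0 -> f1 (mx_eval g q) != 0 ->
    proj_eq (coords (f1 (mx_eval g q))) (mx_eval F (mx_eval phi q)).

(* g(A q)^-1 g(q), meaningful when g is invertible at q and A q. *)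
Definition deck_quot n (g : 'M[binform R n]_2) (A : 'M[C]_2) (q : 'cV[C]_2) :
  'M[C]_2 := invmx (mx_eval g (A *m q)) *m mx_eval g q.

Definition rational_galois_lift d n m (phi : 'cV[binform R d]_2)
    (F : 'cV[binform R m]_7) (g : 'M[binform R n]_2) : Prop :=
  [/\ no_common_factor g, f1_lift phi g F
    & forall A B, covering_transf phi A -> covering_transf phi B ->
      (forall q, mx_eval g q \in unitmx -> mx_eval g (A *m q) \in unitmx ->
         mx_eval g (B *m q) \in unitmx ->
         proj_eq (deck_quot g A q) (deck_quot g B q)) ->
      proj_eq A B].

(* phi2 is determined by g. Writing psi for the homomorphism
   sigma |-> g(sigma q)^-1 g(q), one has g(t^-1 q) = g(q) psi(t) up to scale.
   Since rows are acted upon on the right by phi2(t)^T, the natural action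
   corresponds to g when phi2 lifts the contragredient of psi, that is when
   (phi2(t)^-1)^T represents psi(t); on SU(2) this contragredient is complex
   conjugation, which preserves S_4^*. *)
Definition determined_by_lift d n (phi : 'cV[binform R d]_2)
    (g : 'M[binform R n]_2) (phi1 phi2 : 'M[C]_2 -> 'M[C]_2) : Prop :=
  forall t q, binary_group phi t ->
    mx_eval g q \in unitmx -> mx_eval g (phi1 t *m q) \in unitmx ->
    proj_eq (invmx (phi2 t))^T (deck_quot g (phi1 t) q).

Definition row_vector n (g : 'M[binform R n]_2) (i : 'I_2) :
  binform R n * binform R n := (g i 0, g i 1).

End BinaryForms.

(* Main.v *)
Require Import Defs.
From HB Require Import structures.
From mathcomp Require Import all_boot all_order all_algebra.
From mathcomp Require Import boolp reals complex mpoly.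
From mathcomp Require Import ring.

Set Implicit Arguments.
Unset Strict Implicit.
Unset Printing Implicit Defensive.

Import Order.TTheory GRing.Theory Num.Theory.
Local Open Scope ring_scope.

(** Why the theorem holds.

    The direct statement. For [t] in the binary group, the relation between [g]
    and [phi2] says that at generic points [q] the matrices
    [g (phi1 t q) (phi2 t)^-T] and [g q] are proportional. Their entries are
    forms of the same degree, and those of [g] have no common zero, so the
    factor does not depend on [q] ([homog_proportional_generic]): both rows of
    [g] are eigenvectors of [t], with the same eigenvalue
    ([rows_semi_invariant]). This argument, and the independence of the rows,
    need [det g] to be nonzero somewhere. If it vanished identically, the values
    of [f1 o g] would be sixth powers of linear forms, hence limits of points of
    the orbit of [u^5 v] ([f1_singular]); as [phi] is surjective, the whole curve
    would lie in the closure of that orbit ([lift_generically_invertible]).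

    The converse. On a sum of copies of one character, each [t] acts by a scalar
    ([isotypic_scalar]), so [g (phi1 t q)] is [g q (phi2 t)^T] up to a constant.
    The binary octahedral group preserves the octahedral form up to constants
    ([f1_S4star]), hence the seven coefficients of [f1 o g], which are forms in
    the source variables, are all multiplied by the same constant under each
    covering transformation. What remains is that such a tuple of forms factors
    through [phi].

    For two forms [e] and [f] of one degree with the same multipliers, the
    quotient [e / f] is a rational function of [phi]
    ([invariant_ratio_descends]), by induction on the degree. The member of the
    pencil spanned by [e] and [f] that vanishes at a generic point [q] vanishes
    on its orbit. The orbit has [d] points, so it is the whole fibre of [phi]
    through [q], and that member is divisible by the form of degree [d] cutting
    out the fibre, which is a linear form evaluated at [phi]. Dividing two
    members of the pencil in this way leaves a pair of degree smaller by [d]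
    with common multipliers. Clearing denominators and common factors then
    produces [F] ([invariant_map_descends]), and it is unique because [phi] is
    surjective ([descent_unique]). *)

Local Notation ev q p := (meval (fun i : 'I_2 => q i ord0) p).

(** * Polynomials vanishing everywhere *)

Section Polynomials.
Variable K : closedFieldType.

Lemma poly_eq0_horner (p : {poly K}) : (forall x, p.[x] = 0) -> p = 0.
Proof.
move=> p0; apply/eqP/negP => /negP /closed_nonrootP [x].
by rewrite /root p0 eqxx.
Qed.

Lemma widen_lift_max n (i : 'I_n) : widen_ord (leqnSn n) i = lift ord_max i.
Proof. by apply/val_inj; rewrite /= /bump leqNgt ltn_ord. Qed.

Lemma mcoeff_muni n (p : {mpoly K[n.+1]}) (m : 'X_{1..n.+1}) :
  (muni p)`_(m ord_max) @_[multinom m (widen_ord (leqnSn n) i) | i < n] = p@_m.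
Proof.
rewrite muniE coef_sum raddf_sum /=.
have term m' : (p@_m' *: 'X_[[multinom m' (widen_ord (leqnSn n) i) | i < n]]
      *: 'X^(m' ord_max) : {poly {mpoly K[n]}})`_(m ord_max)
      @_[multinom m (widen_ord (leqnSn n) i) | i < n] = p@_m' * (m' == m)%:R.
  rewrite coefZ coefXn; have [<-|ne] := eqVneq m' m.
    by rewrite eqxx !mulr1 mcoeffZ mcoeffX eqxx mulr1.
  rewrite mulr0; case: eqVneq => [e|_]; last by rewrite mulr0 mcoeff0.
  rewrite mulr1 mcoeffZ mcoeffX; case: eqP => [/mnmP e'|_]; last by rewrite mulr0.
  case/eqP: ne; apply/mnmP => i; case: (unliftP ord_max i) => [j|] ->; last by [].
  have := e' j; rewrite !mnmE.
  by rewrite widen_lift_max.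
under eq_bigr do rewrite term.
have [sm|sm] := boolP (m \in msupp p).
  rewrite (bigD1_seq m) ?msupp_uniq //= eqxx mulr1 big1 ?addr0 // => i /negPf ->.
  by rewrite mulr0.
rewrite (memN_msupp_eq0 sm) big1_seq // => i /andP[_ si].
by rewrite (_ : i == m = false) ?mulr0 //; apply: contraNF sm => /eqP <-.
Qed.

Lemma horner_map_muni n (p : {mpoly K[n.+1]}) (v : 'I_n -> K) x :
  (map_poly (meval v) (muni p)).[x] =
  p.@[fun i => oapp v x (unlift ord_max i)].
Proof.
rewrite muniE rmorph_sum /= horner_sum mevalE; apply: eq_bigr => m _.
rewrite map_polyZ /= map_polyXn hornerZ hornerXn mevalZ mevalX -mulrA.
rewrite big_ord_recr /= unlift_none /=; congr (_ * (_ * _)).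
apply: eq_bigr => i _; rewrite mnmE.
by rewrite widen_lift_max liftK.
Qed.

(** Induction on the number of variables: [muni] views a polynomial as
    univariate over the polynomials in the remaining variables, and a closed
    field is infinite. *)
Lemma mpoly_eq0_meval n (p : {mpoly K[n]}) : (forall v, p.@[v] = 0) -> p = 0.
Proof.
elim: n p => [|n IHn] p p0.
  by have := p0 (fun=> 0); rewrite (nvar0_mpolyC p) mevalC => ->.
have u0 : muni p = 0.
  apply/polyP => k; rewrite coef0; apply: IHn => v.
  have -> : ((muni p)`_k).@[v] = (map_poly (meval v) (muni p))`_k by rewrite coef_map.
  suff -> : map_poly (meval v) (muni p) = 0 by rewrite coef0.
  by apply: poly_eq0_horner => x; rewrite horner_map_muni.
by apply/mpolyP => m; rewrite -mcoeff_muni u0 coef0 !mcoeff0.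
Qed.

Definition restrict_to_line n (a b : 'I_n -> K) : {mpoly K[n]} -> {poly K} :=
  mmap polyC (fun i => (a i)%:P + b i *: 'X).

Lemma horner_restrict_to_line n (a b : 'I_n -> K) (p : {mpoly K[n]}) s :
  (restrict_to_line a b p).[s] = p.@[fun i => a i + s * b i].
Proof.
rewrite /restrict_to_line /meval /mmap horner_sum; apply: eq_bigr => m _.
rewrite hornerM hornerC /mmap1 horner_prod; congr (_ * _).
by apply: eq_bigr => i _; rewrite horner_exp !hornerE mulrC.
Qed.

Lemma meval_homog n k (p : {mpoly K[n]}) c (v : 'I_n -> K) :
  p \is k.-homog -> p.@[fun i => c * v i] = c ^+ k * p.@[v].
Proof.
move=> /dhomogP hp; rewrite !mevalE mulr_sumr; apply: eq_big_seq => m /hp <-.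
rewrite mulrCA [X in c ^+ X](mdegE m) -prodrXr -big_split /=; congr (_ * _).
by apply: eq_bigr => i _; rewrite exprMn.
Qed.
End Polynomials.

(** * Binary forms and their zeros *)

Section BinaryFormZeros.
Variable K : closedFieldType.
Implicit Types (f g h p : {mpoly K[2]}) (q r : 'cV[K]_2) (n : nat).

Definition pt (x y : K) : 'cV[K]_2 := \col_i (if i == 0 then x else y).

Lemma pt_0 x y : pt x y 0 0 = x. Proof. by rewrite mxE. Qed.
Lemma pt_1 x y : pt x y 1 0 = y. Proof. by rewrite mxE. Qed.

Lemma ord2P (P : 'I_2 -> Prop) : P 0 -> P 1 -> forall i, P i.
Proof.
move=> P0 P1 [[|[|//]] i]; first by rewrite (_ : Ordinal i = 0) //; apply/val_inj.
by rewrite (_ : Ordinal i = 1) //; apply/val_inj.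
Qed.

Lemma ptE q : q = pt (q 0 0) (q 1 0).
Proof. by apply/colP; apply: ord2P; rewrite mxE. Qed.

Lemma pt_eq0 x y : (pt x y == 0) = (x == 0) && (y == 0).
Proof.
apply/eqP/andP => [e|[/eqP -> /eqP ->]].
  by move/colP: e => e; move: (e 0) (e 1); rewrite !mxE /= => -> ->.
by apply/colP => i; rewrite !mxE if_same.
Qed.

Lemma neq0_coord q : q != 0 -> q 0 0 != 0 \/ q 1 0 != 0.
Proof. by rewrite [q in q != 0]ptE pt_eq0 negb_and => /orP. Qed.

Lemma evZ n p c q : p \is n.-homog -> ev (c *: q) p = c ^+ n * ev q p.
Proof.
by move=> hp; rewrite -(meval_homog _ _ hp); apply: meval_eq => i; rewrite mxE.
Qed.

(** Setting the first variable to 1 turns a binary form into a univariate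
    polynomial, for which roots and factorization are available; [homogenize]
    goes back. *)
Definition dehomogenize : {mpoly K[2]} -> {poly K} :=
  restrict_to_line (fun i => (i == 0)%:R) (fun i => (i == 1)%:R).

Lemma horner_dehomogenize p s : (dehomogenize p).[s] = ev (pt 1 s) p.
Proof.
rewrite horner_restrict_to_line; apply: meval_eq.
by apply: ord2P; rewrite mxE /= ?mulr0 ?mulr1 ?addr0 ?add0r.
Qed.

Lemma dehomogenizeE p : dehomogenize p = \sum_(m <- msupp p) p@_m *: 'X^(m 1).
Proof.
apply: eq_bigr => m _; rewrite mul_polyC /mmap1 !big_ord_recl big_ord0 /=.
rewrite scale0r addr0 polyC1 expr1n scale1r polyC0 add0r mulr1 mul1r.
by congr (_ *: 'X^(m _)); apply/val_inj.
Qed.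

Lemma homog_exp n p : p \is n.-homog -> {in msupp p, forall m : 'X_{1..2}, (m 0%R + m 1%R = n)%N}.
Proof.
move=> /dhomogP hp m /hp <-; apply: etrans (esym (mdegE m)).
by rewrite !big_ord_recl big_ord0 addn0 /=; congr (m _ + m _)%N; apply/val_inj.
Qed.

Lemma size_dehomogenize n p : p \is n.-homog -> (size (dehomogenize p) <= n.+1)%N.
Proof.
move=> hp; rewrite dehomogenizeE big_seq; apply: (leq_trans (size_sum _ _ _)).
apply/bigmax_leqP_seq => m sm _; apply: (leq_trans (size_scale_leq _ _)).
rewrite size_polyXn; have := homog_exp hp sm; by rewrite ltnS => <-; apply: leq_addl.
Qed.

Lemma coef_dehomogenize n p : p \is n.-homog -> (dehomogenize p)`_n = ev (pt 0 1) p.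
Proof.
move=> hp; rewrite dehomogenizeE coef_sum mevalE; apply: eq_big_seq => m sm.
rewrite coefZ coefXn !big_ord_recl big_ord0 !mxE /= expr1n !mulr1 expr0n.
rewrite -(homog_exp hp sm); congr (_ * _%:R).
by rewrite -[X in _ == X]add0n eqn_add2r eq_sym.
Qed.

Definition homogenize n (u : {poly K}) : {mpoly K[2]} :=
  \sum_(i < n.+1) u`_i *: ('X_0 ^+ (n - i) * 'X_1 ^+ i).

Lemma homogX (i : 'I_2) : ('X_i : {mpoly K[2]}) \is 1.-homog.
Proof. by rewrite dhomogX; apply/eqP; exact: mdeg1. Qed.

Lemma homogXn (i : 'I_2) k : ('X_i ^+ k : {mpoly K[2]}) \is k.-homog.
Proof. by have := dhomogMn k (homogX i); rewrite mul1n. Qed.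

Lemma homog_homogenize n u : homogenize n u \is n.-homog.
Proof.
apply: rpred_sum => i _; apply: dhomogZ.
have e : (n - i + i = n)%N by rewrite subnK // -ltnS.
by rewrite -[X in X.-homog]e; apply: dhomogM; apply: homogXn.
Qed.

Lemma ev_homogenize n (u : {poly K}) s : (size u <= n.+1)%N -> ev (pt 1 s) (homogenize n u) = u.[s].
Proof.
move=> su; rewrite (horner_coef_wide _ su) raddf_sum /=; apply: eq_bigr => i _.
rewrite mevalZ mevalM !rmorphXn /= !mevalXU pt_0 pt_1.
by rewrite expr1n mul1r.
Qed.

Lemma mpolyX0_neq0 : ('X_0 : {mpoly K[2]}) != 0.
Proof.
apply/eqP => /(congr1 (meval (fun=> 1))).
by rewrite mevalXU meval0 => /eqP; rewrite oner_eq0.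
Qed.

(** A multiple by ['X_0] vanishes everywhere, and polynomials have no zero
    divisors. *)
Lemma mpoly_eq0_chart f :
  (forall v : 'I_2 -> K, v 0 != 0 -> f.@[v] = 0) -> f = 0.
Proof.
move=> f0; apply: (mulfI mpolyX0_neq0); rewrite mulr0; apply: mpoly_eq0_meval => v.
rewrite mevalM mevalXU; have [->|/f0 ->] := eqVneq (v 0) 0; first by rewrite mul0r.
by rewrite mulr0.
Qed.

Lemma mpoly_eq0_off_origin f : (forall q, q != 0 -> ev q f = 0) -> f = 0.
Proof.
move=> f0; apply: mpoly_eq0_chart => v v0.
rewrite -(f0 (\col_i v i)); first by apply: meval_eq => i; rewrite mxE.
by apply: contraNneq v0 => /colP /(_ 0); rewrite !mxE => ->.
Qed.

Lemma homog_ext n f g : f \is n.-homog -> g \is n.-homog ->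
  (forall s, ev (pt 1 s) f = ev (pt 1 s) g) -> f = g.
Proof.
move=> hf hg e; apply/eqP; rewrite -subr_eq0; apply/eqP.
have hh : f - g \is n.-homog by apply: rpredB.
apply: mpoly_eq0_chart => v v0.
rewrite (meval_eq (v2 := fun i => (v 0 *: pt 1 (v 1 / v 0)) i ord0)).
  by rewrite (evZ _ _ hh) mevalB e subrr mulr0.
by apply: ord2P; rewrite !mxE /= ?mulr1 // mulrC divfK.
Qed.

Lemma homog0_const p : p \is 0.-homog -> p = (ev (pt 1 0) p)%:MP.
Proof.
move=> hp; apply: (homog_ext hp) => [|s].
  by rewrite -[_%:MP]mulr1 mul_mpolyC; apply/dhomogZ/dhomog1.
rewrite mevalC -!horner_dehomogenize.
by have /size1_polyC -> := size_dehomogenize hp; rewrite !hornerC.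
Qed.

(** The linear form whose only zero on the projective line is [q]. *)
Definition line_form q : {mpoly K[2]} := q 1 0 *: 'X_0 - q 0 0 *: 'X_1.

Lemma ev_line_form q r : ev r (line_form q) = q 1 0 * r 0 0 - q 0 0 * r 1 0.
Proof. by rewrite mevalB !mevalZ !mevalXU. Qed.

Lemma homog_line_form q : line_form q \is 1.-homog.
Proof. by apply: rpredB; apply: dhomogZ; apply: homogX. Qed.

Lemma line_form_neq0 q : q != 0 -> line_form q != 0.
Proof.
move=> q0; apply: contraNneq q0 => l0; rewrite [q]ptE pt_eq0; apply/andP; split.
  by have := ev_line_form q (pt 0 1); rewrite l0 meval0 pt_0 pt_1 mulr0 mulr1 sub0r
    => /esym/eqP; rewrite oppr_eq0.
by have := ev_line_form q (pt 1 0); rewrite l0 meval0 pt_0 pt_1 mulr0 mulr1 subr0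
  => /esym/eqP.
Qed.

(** In the chart where the first coordinate is 1 this is the factor theorem.
    At the point at infinity, vanishing means that the coefficient of top degree
    is zero, so that the dehomogenized form already has smaller degree. *)
Lemma homog_zero_factor n f q : f \is n.+1.-homog -> q != 0 -> ev q f = 0 ->
  exists2 f', f' \is n.-homog & f = line_form q * f'.
Proof.
move=> hf q0 fq.
suff [u su eu] : exists2 u : {poly K}, (size u <= n.+1)%N &
    forall s, ev (pt 1 s) f = (q 1 0 - q 0 0 * s) * u.[s].
  exists (homogenize n u); first exact: homog_homogenize.
  apply: (homog_ext hf) => [|s]; first exact: (dhomogM (homog_line_form q) (homog_homogenize n u)).
  by rewrite eu mevalM ev_line_form ev_homogenize // pt_0 pt_1 mulr1.
have [x0|x0] := eqVneq (q 0 0) 0.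
  have y0 : q 1 0 != 0 by case: (neq0_coord q0) => //; rewrite x0 eqxx.
  exists ((q 1 0)^-1 *: dehomogenize f).
    apply: (leq_trans (size_scale_leq _ _)); apply/leq_sizeP => j.
    rewrite leq_eqVlt => /orP[/eqP <-|lt]; last first.
      by rewrite nth_default // (leq_trans (size_dehomogenize hf)).
    rewrite (coef_dehomogenize hf); move/eqP: fq.
    have -> : q = q 1 0 *: pt 0 1.
      by apply/colP; apply: ord2P; rewrite !mxE /= ?mulr0 ?mulr1.
    by rewrite (evZ _ _ hf) mulf_eq0 expf_eq0 (negPf y0) => /eqP.
  by move=> s; rewrite x0 mul0r subr0 hornerZ mulVKf // horner_dehomogenize.
have /factor_theorem [u eu] : root (dehomogenize f) (q 1 0 / q 0 0).
  rewrite /root horner_dehomogenize; move/eqP: fq.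
  have {1}-> : q = q 0 0 *: pt 1 (q 1 0 / q 0 0).
    by apply/colP; apply: ord2P; rewrite !mxE /= ?mulr1 // mulrC divfK.
  by rewrite (evZ _ _ hf) mulf_eq0 expf_eq0 (negPf x0).
exists (- (q 0 0)^-1 *: u) => [|s].
  apply: (leq_trans (size_scale_leq _ _)).
  have [->|u0] := eqVneq u 0; first by rewrite size_poly0.
  by have := size_dehomogenize hf; rewrite eu size_Mmonic ?monicXsubC // size_XsubC addn2.
rewrite -horner_dehomogenize eu hornerM hornerXsubC hornerZ; field; exact: x0.
Qed.

(** Either the dehomogenized form has a root, or it is constant and the form
    vanishes at infinity. *)
Lemma homog_has_zero n f : f \is n.+1.-homog -> exists2 q : 'cV[K]_2, q != 0 & ev q f = 0.
Proof.
move=> hf; have [s1|s1] := boolP (size (dehomogenize f) == 1%N).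
  exists (pt 0 1); first by rewrite pt_eq0 oner_eq0 andbF.
  by rewrite -(coef_dehomogenize hf) nth_default // (eqP s1).
have [x /rootP fx] := closed_rootP _ s1; exists (pt 1 x); rewrite -?horner_dehomogenize //.
by rewrite pt_eq0 oner_eq0.
Qed.

Lemma ev_homog0 n f q : f \is n.-homog -> q != 0 -> ev q f = 0 ->
  exists h, f = line_form q * h.
Proof.
case: n => [|n] hf q0 fq; last by have [h _ ->] := homog_zero_factor hf q0 fq; exists h.
by exists 0; move: fq; rewrite (homog0_const hf) mevalC => ->; rewrite mulr0 mpolyC0.
Qed.

Definition common_zero_free (I : Type) (g : I -> {mpoly K[2]}) : Prop :=
  forall q : 'cV[K]_2, q != 0 -> exists i, ev q (g i) != 0.

(** Unique factorization in the form that the descent uses: as the [g i] have no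
    common zero, [a] divides [b] as soon as it divides every [b * g i], and the
    degrees being equal, the cofactor is a constant. Each zero of [a] is a zero
    of [b], since some [g i] is nonzero there, so linear factors can be cancelled
    one at a time. *)
Lemma homog_dvd_const (I : Type) n (g c : I -> {mpoly K[2]}) a b :
  common_zero_free g -> a \is n.-homog -> b \is n.-homog -> a != 0 ->
  (forall i, b * g i = a * c i) -> exists k : K, b = k *: a.
Proof.
move=> hg; elim: n a b => [|n IHn] a b ha hb a0 e.
  exists (ev (pt 1 0) b / ev (pt 1 0) a).
  have a1 : ev (pt 1 0) a != 0.
    by apply: contraNneq a0 => a1; rewrite (homog0_const ha) a1 mpolyC0.
  rewrite (homog0_const hb) {2}(homog0_const ha) -mul_mpolyC -mpolyCM divfK //.
  by rewrite mevalC.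
have [q q0 aq] := homog_has_zero ha.
have [i gi] := hg q q0.
have bq : ev q b = 0.
  have := congr1 (meval (fun i => q i ord0)) (e i); rewrite !mevalM aq mul0r.
  by move/eqP; rewrite mulf_eq0 (negPf gi) orbF => /eqP.
have [a' ha' ea] := homog_zero_factor ha q0 aq.
have [b' hb' eb] := homog_zero_factor hb q0 bq.
have [|i'|k ek] := IHn a' b' ha' hb'.
- by apply: contraNneq a0 => a'0; rewrite ea a'0 mulr0.
- by apply: (mulfI (line_form_neq0 q0)); rewrite !mulrA -ea -eb e.
by exists k; rewrite ea eb ek scalerAr.
Qed.

(** Equality of two maps from the projective line to a projective space,
    given by forms of the same degree, lifts to equality up to a constant as soon
    as one of the families has no common zero. *)
Lemma homog_proportional (I : Type) n (g h : I -> {mpoly K[2]}) :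
  (forall i, g i \is n.-homog) -> (forall i, h i \is n.-homog) ->
  common_zero_free g -> (forall i j, h i * g j = h j * g i) ->
  exists k : K, forall i, h i = k *: g i.
Proof.
move=> homg homh hg e.
have [i gi] : exists i, g i != 0.
  have [|i gi] := hg (pt 1 0); first by rewrite pt_eq0 oner_eq0.
  by exists i; apply: contraNneq gi => ->; rewrite meval0.
have [j|k ek] := homog_dvd_const hg (homg i) (homh i) gi (c := h).
  by rewrite e mulrC.
exists k => j; apply: (mulIf gi); rewrite e ek -!scalerAl; congr (_ *: _).
by rewrite mulrC.
Qed.

(** For maps that are known to agree only where [p] does not vanish, with a
    factor that may depend on the point. *)
Lemma homog_proportional_generic (I : Type) n (g h : I -> {mpoly K[2]}) p :
  (forall i, g i \is n.-homog) -> (forall i, h i \is n.-homog) ->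
  common_zero_free g -> p != 0 ->
  (forall q, ev q p != 0 -> exists c, forall i, ev q (h i) = c * ev q (g i)) ->
  exists k : K, forall i, h i = k *: g i.
Proof.
move=> homg homh hg p0 e; apply: (homog_proportional homg homh hg) => i j.
apply: (mulfI p0); apply/eqP; rewrite -subr_eq0; apply/eqP.
apply: mpoly_eq0_off_origin => q _; rewrite mevalB !mevalM.
have [->|/e [c ec]] := eqVneq (ev q p) 0; first by rewrite !mul0r subrr.
by rewrite !ec; ring.
Qed.

(** Removing common zeros one by one lowers the degree. *)
Lemma homog_gcd (I : finType) n (e : I -> {mpoly K[2]}) :
  (forall i, e i \is n.-homog) -> (exists i, e i != 0) ->
  exists m h, [/\ h != 0 & exists2 g : I -> {mpoly K[2]},
    (forall i, g i \is m.-homog) & common_zero_free g /\ forall i, e i = h * g i].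
Proof.
elim: n e => [|n IHn] e he [i0 ei0].
  exists 0%N, 1; split; first exact: oner_neq0.
  exists e => //; split=> [q _|i]; last by rewrite mul1r.
  exists i0; apply: contraNneq ei0; rewrite (homog0_const (he i0)) mevalC => ->.
  by rewrite mpolyC0.
have [z|nz] := pselect (exists2 q : 'cV[K]_2, q != 0 & forall i, ev q (e i) = 0).
  have [q q0 eq0] := z.
  have /fin_all_exists2 [e' he' ee'] i := homog_zero_factor (he i) q0 (eq0 i).
  have [|m [h [h0 [g hg [zg eg]]]]] := IHn e' he'.
    by exists i0; apply: contraNneq ei0 => e0; rewrite ee' e0 mulr0.
  exists m, (line_form q * h); split; first by rewrite mulf_neq0 ?line_form_neq0.
  by exists g => //; split=> // i; rewrite ee' eg mulrA.
exists n.+1, 1; split; first exact: oner_neq0.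
exists e => //; split=> [q q0|i]; last by rewrite mul1r.
apply: contrapT => ne; apply: nz; exists q => // i; apply/eqP/negP => /negP ei.
by apply: ne; exists i.
Qed.

(** Along a line that avoids the origin, such a polynomial is univariate
    without roots, hence constant. Any two nonzero points are joined by at most
    two such lines. *)
Lemma mpoly_no_zero_const h :
  (forall q, q != 0 -> ev q h != 0) -> exists c : K, h = c%:MP.
Proof.
move=> nz.
have seg q r : (forall s, q + s *: (r - q) != 0) -> ev q h = ev r h.
  move=> away; pose u := restrict_to_line (fun i => q i ord0) (fun i => (r - q) i ord0) h.
  have eu s : u.[s] = ev (q + s *: (r - q)) h.
    by rewrite horner_restrict_to_line; apply: meval_eq => i; rewrite !mxE.
  have su : size u == 1%N.
    apply/negPn/negP => /closed_rootP [s /rootP].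
    by rewrite eu => /eqP; apply/negP/nz.
  have /size1_polyC uc : (size u <= 1)%N by rewrite (eqP su).
  have := eu 0; have := eu 1; rewrite uc !hornerC scale0r addr0 scale1r.
  by rewrite addrC subrK => <- <-.
have indep q r : q 0 0 * r 1 0 - q 1 0 * r 0 0 != 0 -> ev q h = ev r h.
  move=> d; apply: seg => s; apply: contraNneq d => /colP z.
  have := z 0; have := z 1; rewrite !mxE => z1 z0.
  have -> : q 0 0 * r 1 0 - q 1 0 * r 0 0 =
      (q 0 0 + s * (r 0 0 - q 0 0)) * (r 1 0 - q 1 0) -
      (q 1 0 + s * (r 1 0 - q 1 0)) * (r 0 0 - q 0 0) by ring.
  by rewrite z0 z1 !mul0r subrr.
have main q : q != 0 -> ev q h = ev (pt 1 0) h.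
  move=> q0; have [y0|y0] := eqVneq (q 1 0) 0; last first.
    by apply: indep; rewrite pt_0 pt_1 mulr0 mulr1 sub0r oppr_eq0.
  have x0 : q 0 0 != 0 by case: (neq0_coord q0) => //; rewrite y0 eqxx.
  rewrite (indep q (pt 0 1)) ?(indep (pt 0 1) (pt 1 0)) ?pt_0 ?pt_1 //.
    by rewrite mul0r mulr1 sub0r oppr_eq0 oner_eq0.
  by rewrite y0 mul0r mulr1 subr0.
exists (ev (pt 1 0) h); apply/eqP; rewrite -subr_eq0; apply/eqP/mpoly_eq0_off_origin => q q0.
by rewrite mevalB mevalC main // subrr.
Qed.
End BinaryFormZeros.

Lemma sum_ord2 (V : nmodType) (F : 'I_2 -> V) : \sum_(i < 2) F i = F 0 + F 1.
Proof.
rewrite !big_ord_recl big_ord0 addr0; congr (F _ + F _); exact/val_inj.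
Qed.

Lemma det_mx2 (A : comRingType) (M : 'M[A]_2) :
  \det M = M 0 0 * M 1 1 - M 0 1 * M 1 0.
Proof.
rewrite (expand_det_row _ 0) sum_ord2 /cofactor !det_mx11 !mxE /= expr0 expr1.
rewrite mul1r mulN1r mulrN; congr (_ * M _ _ - _ * M _ _); exact/val_inj.
Qed.

(** * Descent of invariant forms through a Galois covering *)

Section Descent.
Variable K : closedFieldType.
Implicit Types (f g h p e : {mpoly K[2]}) (q r : 'cV[K]_2) (n : nat).

(** The determinant of two points; it vanishes exactly when they coincide on the
    projective line. *)
Definition cross q r : K := q 1 0 * r 0 0 - q 0 0 * r 1 0.

Lemma cross_eq0P q r : q != 0 -> cross q r = 0 -> exists c, r = c *: q.
Proof.
rewrite /cross => q0 /eqP; rewrite subr_eq0 => /eqP e.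
case: (neq0_coord q0) => z; [exists (r 0 0 / q 0 0)|exists (r 1 0 / q 1 0)].
  apply/colP; apply: ord2P; rewrite mxE ?divfK //.
  by apply: (mulfI z); rewrite -e; field.
apply/colP; apply: ord2P; rewrite mxE ?divfK //.
by apply: (mulfI z); rewrite e; field.
Qed.

Lemma homog_zeros_factor (s : seq 'cV[K]_2) n f :
  all (fun a => a != 0) s -> pairwise (fun a b => cross a b != 0) s ->
  f \is n.-homog -> (forall a, a \in s -> ev a f = 0) ->
  ((n < size s)%N -> f = 0) /\
  exists2 f', f' \is (n - size s).-homog & f = (\prod_(a <- s) line_form a) * f'.
Proof.
elim: s n f => [|a s IHs] n f /=.
  by move=> _ _ hf _; split=> //; exists f; rewrite ?subn0 // big_nil mul1r.
move=> /andP[a0 s0] /andP[/allP as_ ps] hf z.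
case: n hf => [|n] hf.
  have f0 : f = 0.
    by rewrite (homog0_const hf); move: (z a (mem_head _ _));
       rewrite {1}(homog0_const hf) mevalC => ->; rewrite mpolyC0.
  by split=> //; exists 0; rewrite ?mulr0 // dhomog0.
have [f1 hf1 e1] := homog_zero_factor hf a0 (z a (mem_head _ _)).
have [|lt [f' hf' e']] := IHs n f1 s0 ps hf1.
  move=> b sb; have := z b; rewrite inE sb orbT => /(_ isT) /eqP.
  by rewrite e1 mevalM ev_line_form mulf_eq0 (negPf (as_ b sb)) => /eqP.
split; first by rewrite ltnS => /lt f10; rewrite e1 f10 mulr0.
by exists f'; rewrite ?subSS // big_cons e1 e' mulrA.
Qed.

(** Both forms are divisible by the product of the linear forms at the given
    points, and for [h] the cofactor is a constant by its degree. *)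
Lemma homog_same_zeros (s : seq 'cV[K]_2) n f h :
  all (fun a => a != 0) s -> pairwise (fun a b => cross a b != 0) s ->
  f \is n.-homog -> (forall a, a \in s -> ev a f = 0) ->
  h \is (size s).-homog -> (forall a, a \in s -> ev a h = 0) -> h != 0 ->
  f != 0 -> (size s <= n)%N /\ exists2 f', f' \is (n - size s).-homog & f = h * f'.
Proof.
move=> s0 ps hf zf hh zh h0 f0.
have [lt [f' hf' ef]] := homog_zeros_factor s0 ps hf zf.
split; first by rewrite leqNgt; apply: contra f0 => /lt ->.
have [_ [h']] := homog_zeros_factor s0 ps hh zh.
rewrite subnn => hh' eh.
have c0 : ev (pt 1 0) h' != 0.
  by apply: contraNneq h0 => c0; rewrite eh (homog0_const hh') c0 mpolyC0 mulr0.
exists ((ev (pt 1 0) h')^-1 *: f'); first exact: dhomogZ.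
rewrite ef eh (homog0_const hh') mevalC -mulrA mul_mpolyC scalerA divff //.
by rewrite scale1r.
Qed.

Lemma homog_comp n k (l : 'I_2 -> {mpoly K[2]}) f :
  f \is n.-homog -> (forall i, l i \is k.-homog) ->
  f \mPo [tuple l i | i < 2] \is (k * n).-homog.
Proof.
move=> hf hl; rewrite comp_mpolyE big_seq rpred_sum // => m mf; apply: rpredZ.
rewrite -(homog_exp hf mf) mulnDr !big_ord_recl big_ord0 mulr1 !tnth_mktuple /=.
apply: dhomogM; last rewrite (_ : lift _ _ = 1); try exact: dhomogMn.
by apply/val_inj.
Qed.

Lemma ev_comp (l : 'I_2 -> {mpoly K[2]}) f q :
  ev q (f \mPo [tuple l i | i < 2]) = ev (\col_i ev q (l i)) f.
Proof.
by rewrite comp_mpoly_meval; apply: meval_eq => i; rewrite tnth_mktuple mxE.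
Qed.

Definition linform (B : 'M[K]_2) (i : 'I_2) : {mpoly K[2]} :=
  \sum_(j < 2) B i j *: 'X_j.

Lemma homog_linform B i : linform B i \is 1.-homog.
Proof. by apply: rpred_sum => j _; apply: dhomogZ; apply: homogX. Qed.

Lemma ev_linform B i q : ev q (linform B i) = (B *m q) i 0.
Proof.
rewrite mxE raddf_sum /=; apply: eq_bigr => j _.
by rewrite mevalZ mevalXU.
Qed.

Definition linform_subst (B : 'M[K]_2) f := f \mPo [tuple linform B i | i < 2].

Lemma homog_linform_subst B n f : f \is n.-homog -> linform_subst B f \is n.-homog.
Proof.
by move=> hf; rewrite -[n in n.-homog]mul1n; apply: homog_comp (homog_linform B).
Qed.

Lemma ev_linform_subst B f q : ev q (linform_subst B f) = ev (B *m q) f.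
Proof.
by rewrite ev_comp; apply: meval_eq => i; rewrite mxE ev_linform.
Qed.

(** A matrix for which every vector is an eigenvector is scalar; testing it on
    (1, 0), (0, 1) and (1, 1) suffices. *)
Lemma cross_mulmx_eq0 (A B : 'M[K]_2) : A \in unitmx ->
  (forall q, cross (A *m q) (B *m q) = 0) -> exists c, B = c *: A.
Proof.
move=> uA e; have [C eB] : exists C, B = A *m C.
  by exists (invmx A *m B); rewrite mulmxA mulmxV // mul1mx.
have crossM q r : cross (A *m q) (A *m r) = \det A * cross q r.
  by rewrite /cross det_mx2 !mxE !sum_ord2; ring.
have dA : \det A != 0 by rewrite -unitfE -unitmxE.
have eC q : cross q (C *m q) = 0.
  by apply: (mulfI dA); rewrite -crossM mulmxA -eB e mulr0.
exists (C 0 0); rewrite {1}eB; suff eS : C = (C 0 0)%:M by rewrite {1}eS mul_mx_scalar.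
move: (eC (pt 1 0)) (eC (pt 0 1)) (eC (pt 1 1)).
rewrite /cross !mxE !sum_ord2 !mxE /=.
rewrite !(mul0r, mulr0, mul1r, mulr1, addr0, add0r, subr0, sub0r) => c10 c01 c11.
apply/matrixP; apply: ord2P; apply: ord2P; rewrite !mxE /= ?mulr1n ?mulr0n //.
- by apply/eqP; rewrite -oppr_eq0 c10.
- have c10' : C 1 0 = 0 by apply/eqP; rewrite -oppr_eq0 c10.
  by move: c11; rewrite c01 c10' addr0 add0r => /eqP; rewrite subr_eq0 => /eqP.
Qed.

Variables (d : nat) (phi : 'I_2 -> {mpoly K[2]}) (s : 'I_d -> 'M[K]_2).
Hypothesis d_gt0 : (0 < d)%N.
Hypothesis homog_phi : forall i, phi i \is d.-homog.
Hypothesis phi_czf : common_zero_free phi.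

Definition phi_at q : 'cV[K]_2 := \col_i ev q (phi i).

Lemma phi_at_neq0 q : q != 0 -> phi_at q != 0.
Proof.
move=> q0; have [i fi] := phi_czf q0.
by apply: contraNneq fi => /colP /(_ i); rewrite !mxE => ->.
Qed.


(** The form cutting out the fibre of [phi] over the point [r]. *)
Definition fibre r : {mpoly K[2]} := r 1 0 *: phi 0 - r 0 0 *: phi 1.

Lemma homog_fibre r : fibre r \is d.-homog.
Proof. by apply: rpredB; apply: dhomogZ. Qed.

Lemma ev_fibre r q : ev q (fibre r) = cross r (phi_at q).
Proof. by rewrite mevalB !mevalZ /cross !mxE. Qed.

(** The fibre form has positive degree, hence a zero. *)
Lemma phi_at_surj (p : 'cV[K]_2) : p != 0 ->
  exists2 q : 'cV[K]_2, q != 0 &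
    exists2 c, c != 0 & phi_at q = c *: p.
Proof.
move=> p0; have [q q0 pq] : exists2 q : 'cV[K]_2, q != 0 & ev q (fibre p) = 0.
  by case: d d_gt0 (homog_fibre p) => // d' _; apply: homog_has_zero.
rewrite ev_fibre in pq; have [c ec] := cross_eq0P p0 pq.
exists q => //; exists c => //; have := phi_at_neq0 q0; rewrite ec.
by apply: contraNneq => ->; rewrite scale0r.
Qed.

Lemma fibre_neq0 r : r != 0 -> fibre r != 0.
Proof.
move=> r0.
have [p p0 rp] : exists2 p : 'cV[K]_2, p != 0 & cross r p != 0.
  case: (neq0_coord r0) => z; [exists (pt 0 1)|exists (pt 1 0)];
    rewrite /cross ?pt_eq0 ?pt_0 ?pt_1 ?oner_eq0 ?andbF //.
    by rewrite mulr0 mulr1 sub0r oppr_eq0.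
  by rewrite mulr0 mulr1 subr0.
have [q q0 [c c0 ec]] := phi_at_surj p0.
apply: contraNneq rp => f0; apply/eqP/(mulfI c0); rewrite mulr0.
have := ev_fibre r q; rewrite f0 meval0 ec => ->.
by rewrite /cross !mxE; ring.
Qed.

Lemma mpoly_neq0_ev p : p != 0 -> exists2 q : 'cV[K]_2, q != 0 & ev q p != 0.
Proof.
move=> p0; apply: contrapT => ne; case/eqP: p0; apply: mpoly_eq0_off_origin => q q0.
by apply/eqP/negP => /negP pq; apply: ne; exists q.
Qed.

Lemma comp_phi_neq0 n p : p \is n.-homog -> p != 0 ->
  p \mPo [tuple phi i | i < 2] != 0.
Proof.
move=> hp /mpoly_neq0_ev [r r0 pr]; have [q q0 [c c0 ec]] := phi_at_surj r0.
apply: contraNneq pr => p0; have := ev_comp phi p q; rewrite p0 meval0 -/(phi_at q) ec.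
rewrite (evZ _ _ hp) => /esym/eqP; rewrite mulf_eq0 expf_eq0 (negPf c0) andbF.
by [].
Qed.

Lemma unitmx_mul_neq0 (A : 'M[K]_2) q : A \in unitmx -> q != 0 -> A *m q != 0.
Proof. by move=> uA; apply: contraNneq => e; rewrite -[q](mulKmx uA) e mulmx0. Qed.

(** A covering transformation multiplies the two components of the covering by
    one constant. *)
Lemma deck_scale (A : 'M[K]_2) : A \in unitmx ->
  (forall q, q != 0 -> forall i j,
     ev (A *m q) (phi i) * ev q (phi j) = ev (A *m q) (phi j) * ev q (phi i)) ->
  exists2 c : K, c != 0 & forall i q, ev (A *m q) (phi i) = c * ev q (phi i).
Proof.
move=> uA hA.
have [i j|c ec] := homog_proportional homog_phi
    (fun i => homog_linform_subst A (homog_phi i)) phi_czf.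
  apply/eqP; rewrite -subr_eq0; apply/eqP/mpoly_eq0_off_origin => q q0.
  by rewrite mevalB !mevalM !ev_linform_subst hA // subrr.
have ec' i q : ev (A *m q) (phi i) = c * ev q (phi i).
  by rewrite -ev_linform_subst ec mevalZ.
exists c => //; have e0 : pt 1 0 != 0 :> 'cV[K]_2 by rewrite pt_eq0 oner_eq0.
have [i z] := phi_czf (unitmx_mul_neq0 uA e0); move: z.
by rewrite ec' mulf_eq0 negb_or => /andP[].
Qed.

Hypothesis s_unit : forall k, s k \in unitmx.
Hypothesis s_inj : forall k l c, s l = c *: s k -> k = l.

(** The multipliers [chi] are recorded for the representatives [s k] only; two
    forms with the same [chi] have an invariant quotient. *)
Definition semi_invariant (chi : 'I_d -> K) e : Prop :=
  forall k q, ev (s k *m q) e = chi k * ev q e.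

Variable c_phi : 'I_d -> K.
Hypothesis c_phi_neq0 : forall k, c_phi k != 0.
Hypothesis phi_semi : forall i, semi_invariant c_phi (phi i).

Lemma phi_at_s k q : phi_at (s k *m q) = c_phi k *: phi_at q.
Proof. by apply/colP => i; rewrite !mxE phi_semi. Qed.

Definition deck_orbit q := [seq s k *m q | k <- enum 'I_d].

Lemma size_deck_orbit q : size (deck_orbit q) = d.
Proof. by rewrite size_map size_enum_ord. Qed.

Lemma deck_orbit_neq0 q : q != 0 -> all (fun a => a != 0) (deck_orbit q).
Proof.
move=> q0; apply/allP => _ /mapP [k _ ->]; exact: unitmx_mul_neq0.
Qed.

(** Two distinct covering transformations agree only where a nonzero quadratic
    form vanishes; [G] is the product of these forms. *)
Lemma deck_orbit_generic : exists2 G : {mpoly K[2]}, G != 0 &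
  forall q, ev q G != 0 -> pairwise (fun a b => cross a b != 0) (deck_orbit q).
Proof.
pose w k l := linform (s k) 1 * linform (s l) 0 - linform (s k) 0 * linform (s l) 1.
have ew k l q : ev q (w k l) = cross (s k *m q) (s l *m q).
  by rewrite mevalB !mevalM !ev_linform.
exists (\prod_k \prod_(l | k != l) w k l).
  apply/prodf_neq0 => k _; apply/prodf_neq0 => l kl; apply: contraNneq kl => w0.
  apply/eqP; have [q|c ec] := cross_mulmx_eq0 (s_unit k) (B := s l).
    by rewrite -ew w0 meval0.
  exact: s_inj ec.
move=> q; rewrite rmorph_prod => /prodf_neq0 nz.
rewrite pairwise_map; apply: (@sub_pairwise _ [rel k l | k != l]); last first.
  by rewrite -uniq_pairwise enum_uniq.
move=> k l /= kl; have := nz k isT; rewrite rmorph_prod => /prodf_neq0 /(_ l kl).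
by rewrite /= ew.
Qed.

Lemma semi_invariant_fibre r : semi_invariant c_phi (fibre r).
Proof. by move=> k q; rewrite !ev_fibre phi_at_s /cross !mxE; ring. Qed.

Lemma semi_invariantB chi a b e f :
  semi_invariant chi e -> semi_invariant chi f -> semi_invariant chi (a *: e - b *: f).
Proof. by move=> he hf k q; rewrite !mevalB !mevalZ he hf; ring. Qed.

Lemma semi_invariant_quot chi psi e f h :
  (forall k, psi k != 0) -> h != 0 ->
  semi_invariant chi e -> semi_invariant psi h -> e = h * f ->
  semi_invariant (fun k => chi k / psi k) f.
Proof.
move=> psi0 h0 he hh ee k q.
suff /eqP : h * (linform_subst (s k) f - (chi k / psi k) *: f) = 0.
  rewrite mulf_eq0 (negPf h0) subr_eq0 /= => /eqP/(congr1 (meval (fun i => q i ord0))).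
  by rewrite ev_linform_subst mevalZ.
apply: mpoly_eq0_off_origin => r _.
rewrite mevalM mevalB mevalZ ev_linform_subst.
have := he k r; rewrite ee !mevalM hh => e1.
apply: (mulfI (psi0 k)); rewrite mulr0 mulrBr mulrBr !mulrA e1.
by field; apply: psi0.
Qed.

(** At a generic [q] the orbit consists of [d] distinct points, as many as the
    degree of the form cutting out the fibre through [q]. *)
Lemma fibre_dvd n e q :
  q != 0 -> pairwise (fun a b => cross a b != 0) (deck_orbit q) ->
  e \is n.-homog -> e != 0 -> (forall k, ev (s k *m q) e = 0) ->
  (d <= n)%N /\ exists2 f, f \is (n - d).-homog & e = fibre (phi_at q) * f.
Proof.
move=> q0 pw he e0 ez.
have := @homog_same_zeros (deck_orbit q) n e (fibre (phi_at q)).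
rewrite size_deck_orbit; apply=> //.
- exact: deck_orbit_neq0.
- by move=> _ /mapP [k _ ->].
- exact: homog_fibre.
- by move=> _ /mapP [k _ ->]; rewrite ev_fibre phi_at_s /cross !mxE; ring.
- exact/fibre_neq0/phi_at_neq0.
Qed.

(** The member of the pencil spanned by [e] and [f] that vanishes at [q]. *)
Definition pencil_form e f q := ev q f *: e - ev q e *: f.

(** The field of invariant rational functions is generated by the covering map.
    Two members of the pencil, taken at generic points [q0] and [q1], are divided
    by their fibre forms; the quotients [u] and [v] are again semi-invariant with
    common multipliers and have smaller degree. The relation between [u] and [v]
    given by the induction is then solved for [e] and [f]. *)
Lemma invariant_ratio_descends n chi e f :
  e \is n.-homog -> f \is n.-homog -> f != 0 ->
  semi_invariant chi e -> semi_invariant chi f ->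
  exists m P Q, [/\ P \is m.-homog, Q \is m.-homog, Q != 0 &
    forall q, ev q e * ev (phi_at q) Q = ev q f * ev (phi_at q) P].
Proof.
elim/ltn_ind: n e f chi => n IHn e f chi he hf f0 se sf.
have [[c ec]|np] := pselect (exists c, e = c *: f).
  exists 0%N, c%:MP, 1; split; rewrite ?oner_neq0 ?dhomog1 //.
    by rewrite -[c%:MP]mulr1 mul_mpolyC; apply/dhomogZ/dhomog1.
  by move=> q; rewrite meval1 mevalC ec mevalZ; ring.
have [G G0 gen] := deck_orbit_generic.
have pencil_neq0 q : ev q f != 0 -> pencil_form e f q != 0.
  move=> fq; apply/eqP => /eqP; rewrite subr_eq0 => /eqP ee; apply: np.
  exists (ev q e / ev q f); rewrite mulrC -scalerA -ee scalerA mulVf // scale1r //.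
have [q1 q1_0] := mpoly_neq0_ev (mulf_neq0 f0 G0).
rewrite mevalM mulf_eq0 negb_or => /andP[fq1 Gq1].
have [q0 q0_0] := mpoly_neq0_ev (mulf_neq0 (mulf_neq0 (pencil_neq0 q1 fq1) f0) G0).
rewrite 2!mevalM !mulf_eq0 !negb_or mevalB !mevalZ => /andP[/andP[det0 fq0] Gq0].
have quot q : q != 0 -> ev q f != 0 -> ev q G != 0 ->
    (d <= n)%N /\ exists2 u, u \is (n - d).-homog /\
      semi_invariant (fun k => chi k / c_phi k) u &
      pencil_form e f q = fibre (phi_at q) * u.
  move=> qn0 fq Gq.
  have [] := @fibre_dvd n (pencil_form e f q) q qn0 (gen q Gq) _ (pencil_neq0 q fq).
  - by apply: rpredB; apply: dhomogZ.
  - by move=> k; rewrite mevalB !mevalZ se sf; ring.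
  move=> dn [u hu eu]; split=> //; exists u => //; split=> //.
  apply: (semi_invariant_quot c_phi_neq0 _ _ (semi_invariant_fibre _) eu).
    exact/fibre_neq0/phi_at_neq0.
  exact: semi_invariantB.
have [dn [u [hu su] eu]] := quot q0 q0_0 fq0 Gq0.
have [_ [v [hv sv] ev_]] := quot q1 q1_0 fq1 Gq1.
have v0 : v != 0.
  by apply: contraNneq (pencil_neq0 q1 fq1) => v0; rewrite ev_ v0 mulr0.
have [|m [P [Q [hP hQ Q0 ePQ]]]] := IHn (n - d)%N _ u v _ hu hv v0 su sv.
  by rewrite ltn_subrL d_gt0 (leq_trans d_gt0 dn).
pose P' := line_form (phi_at q0) * P; pose Q' := line_form (phi_at q1) * Q.
have hP' : P' \is m.+1.-homog by apply: (dhomogM (homog_line_form _) hP).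
have hQ' : Q' \is m.+1.-homog by apply: (dhomogM (homog_line_form _) hQ).
have e' q : ev q (pencil_form e f q0) * ev (phi_at q) Q' =
            ev q (pencil_form e f q1) * ev (phi_at q) P'.
  rewrite eu ev_ !mevalM !ev_fibre !ev_line_form -!/(cross _ _).
  by rewrite mulrACA ePQ; ring.
exists m.+1, (ev q0 e *: Q' - ev q1 e *: P'), (ev q0 f *: Q' - ev q1 f *: P').
have hD : (ev q0 f *: Q' - ev q1 f *: P') \is m.+1.-homog.
  by apply: rpredB; apply: dhomogZ.
have eD q : ev q e * ev (phi_at q) (ev q0 f *: Q' - ev q1 f *: P') =
            ev q f * ev (phi_at q) (ev q0 e *: Q' - ev q1 e *: P').
  have := e' q; rewrite !mevalB !mevalZ => e''.
  have key (a b x y z w Qq Pq : K) : (a * x - b * y) * Qq = (z * x - w * y) * Pq ->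
      x * (a * Qq - z * Pq) = y * (b * Qq - w * Pq).
    move=> h; apply/eqP; rewrite -subr_eq0.
    have -> : x * (a * Qq - z * Pq) - y * (b * Qq - w * Pq) =
       (a * x - b * y) * Qq - (z * x - w * y) * Pq by ring.
    by rewrite h subrr.
  exact: key.
split=> //; first by apply: rpredB; apply: dhomogZ.
apply/eqP => D0.
(* A vanishing denominator would make the numerator vanish too, and by det0
   these two relations between P' and Q' are independent. *)
have N0 : ev q0 e *: Q' - ev q1 e *: P' = 0.
  apply/eqP/negP => /negP N0.
  have hN : (ev q0 e *: Q' - ev q1 e *: P') \is m.+1.-homog.
    by apply: rpredB; apply: dhomogZ.
  have /mpoly_neq0_ev [q _] := mulf_neq0 f0 (comp_phi_neq0 hN N0).
  by rewrite mevalM ev_comp -/(phi_at q) -eD D0 meval0 mulr0 eqxx.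
have : (ev q1 f * ev q0 e - ev q1 e * ev q0 f) *: Q' = 0.
  have -> : (ev q1 f * ev q0 e - ev q1 e * ev q0 f) *: Q' =
    ev q1 f *: (ev q0 e *: Q' - ev q1 e *: P') -
    ev q1 e *: (ev q0 f *: Q' - ev q1 f *: P').
    rewrite !scalerBr !scalerA scalerBl (mulrC (ev q1 e) (ev q1 f)).
    by rewrite opprB addrA subrK.
  by rewrite N0 D0 !scaler0 subrr.
move/eqP; rewrite scaler_eq0 (negPf det0) mulf_eq0 (negPf Q0) orbF.
by rewrite (negPf (line_form_neq0 (phi_at_neq0 q1_0))).
Qed.

Lemma homog_prod_fin (I : finType) (m : I -> nat) (p : I -> {mpoly K[2]}) :
  (forall i, p i \is (m i).-homog) -> \prod_i p i \is (\sum_i m i)%N.-homog.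
Proof.
move=> hp; elim/big_rec2: _ => [|i k u _ hu]; first exact: dhomog1.
exact: dhomogM.
Qed.

(** All quotients [e i / e i0] descend with their own denominators;
    [F i] is the numerator over the common denominator, before division by
    the common factor. *)
Lemma invariant_map_descends (I : finType) n chi (e : I -> {mpoly K[2]}) :
  (forall i, e i \is n.-homog) -> (exists i, e i != 0) ->
  (forall i, semi_invariant chi (e i)) ->
  exists m (F : I -> {mpoly K[2]}),
    [/\ forall i, F i \is m.-homog, common_zero_free F &
      forall q i j, ev q (e i) * ev (phi_at q) (F j) = ev q (e j) * ev (phi_at q) (F i)].
Proof.
move=> he [i0 e0] se.
have ratio i : exists t : nat * {mpoly K[2]} * {mpoly K[2]},
    [/\ t.1.2 \is t.1.1.-homog, t.2 \is t.1.1.-homog, t.2 != 0 &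
      forall q, ev q (e i) * ev (phi_at q) t.2 = ev q (e i0) * ev (phi_at q) t.1.2].
  have [m [P [Q [hP hQ Q0 eq]]]] := invariant_ratio_descends (he i) (he i0) e0 (se i) (se i0).
  by exists (m, P, Q).
have {ratio} [t ht] := fin_all_exists ratio.
pose comp p := p \mPo [tuple phi i | i < 2].
have evc p q : ev q (comp p) = ev (phi_at q) p by rewrite ev_comp.
pose F i := \prod_j (if j == i then (t j).1.2 else (t j).2).
pose D := \prod_j (t j).2.
have hF i : F i \is (\sum_j (t j).1.1)%N.-homog.
  by apply: homog_prod_fin => j; case: (ht j) => *; case: ifP.
have hD : D \is (\sum_j (t j).1.1)%N.-homog.
  by apply: homog_prod_fin => j; case: (ht j).
have D0 : D != 0 by apply/prodf_neq0 => j _; case: (ht j).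
have FD i q : ev q (e i0) * ev (phi_at q) (F i) = ev q (e i) * ev (phi_at q) D.
  rewrite /F /D (bigD1 i) //= eqxx [in RHS](bigD1 i) //= !mevalM !mulrA.
  case: (ht i) => _ _ _ ->; congr (_ * meval _ _).
  by apply: eq_bigr => j /negPf ->.
have Fi0 : comp (F i0) != 0.
  apply: contraNneq (mulf_neq0 e0 (comp_phi_neq0 hD D0)) => z.
  apply/eqP/mpoly_eq0_off_origin => q _.
  by rewrite mevalM evc -FD -evc z meval0 mulr0.
have [|m [h [h0 [F' hF' [zF' eF]]]]] := homog_gcd hF.
  by exists i0; apply: contraNneq Fi0 => ->; rewrite /comp comp_mpoly0.
exists m, F'; split=> // q i j; apply/eqP; rewrite -subr_eq0 -!evc -!mevalM -mevalB.
suff /eqP -> : e i * comp (F' j) - e j * comp (F' i) == 0 by rewrite meval0.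
have nz : e i0 * comp h != 0.
  rewrite mulf_neq0 //; apply: contraNneq Fi0 => z.
  by rewrite /comp eF rmorphM /= -/(comp h) z mul0r.
apply/eqP/(mulfI nz); rewrite mulr0; apply: mpoly_eq0_off_origin => r _.
have FD' k : ev r (e i0) * (ev (phi_at r) h * ev (phi_at r) (F' k)) =
    ev r (e k) * ev (phi_at r) D by rewrite -mevalM -eF.
rewrite !(mevalM, mevalB) !evc.
transitivity (ev r (e i) * (ev r (e i0) * (ev (phi_at r) h * ev (phi_at r) (F' j))) -
  ev r (e j) * (ev r (e i0) * (ev (phi_at r) h * ev (phi_at r) (F' i)))); first by ring.
by rewrite !FD'; ring.
Qed.

Lemma descent_unique (I : Type) m m' (e F F' : I -> {mpoly K[2]}) :
  (exists i, e i != 0) ->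
  (forall i, F i \is m.-homog) -> (forall i, F' i \is m'.-homog) ->
  (forall q i j, q != 0 -> ev q (e i) * ev (phi_at q) (F j) = ev q (e j) * ev (phi_at q) (F i)) ->
  (forall q i j, q != 0 -> ev q (e i) * ev (phi_at q) (F' j) = ev q (e j) * ev (phi_at q) (F' i)) ->
  forall i j, F i * F' j = F j * F' i.
Proof.
move=> [i0 e0] hF hF' eF eF' i j; apply/eqP; rewrite -subr_eq0; apply/negPn/negP.
have hD : F i * F' j - F j * F' i \is (m + m')%N.-homog.
  by apply: rpredB; apply: dhomogM.
move=> /(comp_phi_neq0 hD) D0.
have /mpoly_neq0_ev [q q0] := mulf_neq0 (mulf_neq0 e0 e0) D0.
rewrite !mevalM ev_comp -/(phi_at q) mevalB !mevalM => /eqP; apply.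
transitivity
  ((ev q (e i0) * ev (phi_at q) (F i)) * (ev q (e i0) * ev (phi_at q) (F' j)) -
   (ev q (e i0) * ev (phi_at q) (F j)) * (ev q (e i0) * ev (phi_at q) (F' i))).
  by ring.
by rewrite !(eF q i0) // !(eF' q i0) //; ring.
Qed.
End Descent.

(** * The octahedral form and its stabilizer *)

Section OctahedralForm.
Variable R : realType.
Local Notation C := R[i].
Implicit Types (q : 'cV[C]_2).

Lemma evalf_lin_subst (B : 'M[C]_2) n (f : binform R n) q :
  evalf (lin_subst B f) q = evalf f (B *m q).
Proof. exact: (ev_linform_subst B). Qed.

Definition entries k l n (F : 'M[binform R n]_(k, l)) (ij : 'I_k * 'I_l) :
  {mpoly C[2]} := F ij.1 ij.2.

Lemma homog_entries k l n (F : 'M[binform R n]_(k, l)) ij : entries F ij \is n.-homog.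
Proof. exact: dhomog_is_dhomog. Qed.

(** A common zero yields a common linear factor; conversely a common factor that
    is not constant has zeros away from the origin, and these are common zeros. *)
Lemma no_common_factorP k l n (F : 'M[binform R n]_(k, l)) :
  no_common_factor F <-> common_zero_free (entries F).
Proof.
split=> [ncf q q0|czf h hF].
  apply: contrapT => ne.
  have z ij : ev q (entries F ij) = 0.
    by apply/eqP/negP => /negP z; apply: ne; exists ij.
  have [i j|c ec] := ncf (line_form q).
    by have [p ep] := ev_homog0 (homog_entries F (i, j)) q0 (z (i, j)); exists p.
  have := line_form_neq0 q0; rewrite ec; have := ev_line_form q q.
  rewrite ec mevalC mulrC subrr => ->.
  by rewrite mpolyC0 eqxx.
apply: mpoly_no_zero_const => q q0; have [[i j]] := czf q q0.
have [p ep] := hF i j; rewrite /entries /= ep mevalM.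
by apply: contraNneq => ->; rewrite mul0r.
Qed.

Lemma mx_eval_neq0 k l n (F : 'M[binform R n]_(k, l)) q :
  no_common_factor F -> q != 0 -> mx_eval F q != 0.
Proof.
move=> /no_common_factorP czf q0; have [[i j] z] := czf q q0.
by apply: contraNneq z => /matrixP /(_ i j); rewrite !mxE => z; apply/eqP/z.
Qed.

Lemma octa_scale (a b c : C) (l1 l2 : binform R 1) :
  a * b = 1 -> a ^+ 4 = c -> b ^+ 4 = c -> octa (a *: l1) (b *: l2) = c *: octa l1 l2.
Proof.
move=> ab a4 b4; apply/val_inj => /=; rewrite -!mul_mpolyC.
transitivity ((a * b)%:MP * (l1 : {mpoly C[2]}) * l2 *
    ((a ^+ 4)%:MP * (l1 : {mpoly C[2]}) ^+ 4 - (b ^+ 4)%:MP * (l2 : {mpoly C[2]}) ^+ 4)).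
  by rewrite mpolyCM !rmorphXn /=; ring.
rewrite ab a4 b4 mpolyC1; ring.
Qed.

(** For [s] = 1 / sqrt 2 this is the substitution made by [octa_gen2]. *)
Lemma octa_rotate (s : C) (l1 l2 : binform R 1) :
  octa (s *: (l1 - l2)) (s *: (l1 + l2)) = (- (s ^+ 6 *+ 8)) *: octa l1 l2.
Proof.
apply/val_inj => /=; rewrite -!mul_mpolyC mpolyCN mpolyCMn rmorphXn /=; ring.
Qed.

Lemma sqr_invsqrt2 : (Num.sqrt 2%:R : R)^-1 * (Num.sqrt 2%:R)^-1 = 2%:R^-1.
Proof. by rewrite -invfM -expr2 sqr_sqrtr ?ler0n. Qed.

Lemma half_half : 2%:R^-1 + 2%:R^-1 = 1 :> R.
Proof. by field. Qed.

(** [z] is a primitive eighth root of unity and [w] its conjugate, so that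
    [w z = 1] and [z^4 = w^4 = -1]. *)
Lemma f1_gen1 (M : 'M[C]_2) : f1 (M *m (octa_gen1 R)^T) = (-1) *: f1 M.
Proof.
pose s : R := (Num.sqrt 2%:R)^-1; pose z : C := Complex s s; pose w : C := Complex s (- s).
have g1 i : (M *m (octa_gen1 R)^T) i 0 = z * M i 0.
  by rewrite !mxE sum_ord2 !mxE /= mulr0 addr0 mulrC.
have g2 i : (M *m (octa_gen1 R)^T) i 1 = w * M i 1.
  by rewrite !mxE sum_ord2 !mxE /= mulr0 add0r mulrC.
have ss : s * s = 2%:R^-1 by exact: sqr_invsqrt2.
have wz : w * z = 1.
  apply/eqP; rewrite eq_complex /= !mulNr ss opprK half_half subrr.
  by rewrite !eqxx.
have z2 : z * z = Complex 0 1.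
  by apply/eqP; rewrite eq_complex /= ss subrr half_half !eqxx.
have w2 : w * w = Complex 0 (-1).
  apply/eqP; rewrite eq_complex /= !mulrN !mulNr opprK ss subrr -opprD half_half.
  by rewrite !eqxx.
have z4 : z ^+ 4 = -1.
  rewrite (exprM z 2 2) !expr2 z2; apply/eqP.
  by rewrite eq_complex /= !mul0r !mul1r add0r addr0 oppr0 !eqxx.
have w4 : w ^+ 4 = -1.
  by rewrite (exprM w 2 2) !expr2 w2; apply/eqP; rewrite eq_complex /=
    !mul0r !mulr0 mulrNN mul1r sub0r addr0 oppr0 !eqxx.
pose l1 : binform R 1 := M 1 1 *: var R 0 - M 0 1 *: var R 1.
pose l2 : binform R 1 := M 0 0 *: var R 1 - M 1 0 *: var R 0.
have -> : f1 M = octa l1 l2 by [].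
rewrite -(octa_scale l1 l2 wz w4 z4) /f1 !g1 !g2.
by rewrite -!scalerA -!scalerBr.
Qed.

Lemma f1_gen2 (M : 'M[C]_2) : f1 (M *m (octa_gen2 R)^T) = (-1) *: f1 M.
Proof.
pose s : C := ((Num.sqrt 2%:R)^-1 : R)%:C%C.
have g1 i : (M *m (octa_gen2 R)^T) i 0 = s * (M i 0 - M i 1).
  by rewrite !mxE sum_ord2 !mxE /= -/s; ring.
have g2 i : (M *m (octa_gen2 R)^T) i 1 = s * (M i 0 + M i 1).
  by rewrite !mxE sum_ord2 !mxE /= -/s; ring.
have s6 : - (s ^+ 6 *+ 8) = -1.
  have s2 : s ^+ 2 = 2%:R^-1.
    by rewrite expr2 /s -rmorphM /= sqr_invsqrt2 fmorphV rmorph_nat.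
  by rewrite (exprM s 2 3) s2; field.
pose l1 : binform R 1 := M 1 1 *: var R 0 - M 0 1 *: var R 1.
pose l2 : binform R 1 := M 0 0 *: var R 1 - M 1 0 *: var R 0.
have -> : f1 M = octa l1 l2 by [].
rewrite -s6 -(octa_rotate s l1 l2) /f1 !g1 !g2 -!scalerA -!scalerBr.
have -> : (M 1 0 + M 1 1) *: var R 0 - (M 0 0 + M 0 1) *: var R 1 = l1 - l2.
  by apply/val_inj; rewrite /l1 /l2 /= -!mul_mpolyC !mpolyCD; ring.
have -> : (M 0 0 - M 0 1) *: var R 1 - (M 1 0 - M 1 1) *: var R 0 = l1 + l2.
  by apply/val_inj; rewrite /l1 /l2 /= -!mul_mpolyC !mpolyCB; ring.
by [].
Qed.

Lemma S4star_unitmx (A : 'M[C]_2) : S4star A -> A \in unitmx.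
Proof.
elim=> {A} [||||].
- rewrite unitmxE det_mx2 !mxE /= mul0r subr0 unitfE; apply/eqP => /eqP.
  by rewrite mulf_eq0 !eq_complex /= oppr_eq0 andbb !invr_eq0 sqrtr_eq0 lern0.
- rewrite unitmxZ; last first.
    by rewrite unitfE eq_complex /= eqxx andbT invr_eq0 sqrtr_eq0 lern0.
  by rewrite unitmxE det_mx2 !mxE /= !mulr1 opprK unitfE -mulr2n pnatr_eq0.
- exact: unitmx1.
- by move=> A B _ uA _ uB; rewrite unitmx_mul uA.
by move=> A _ uA; rewrite unitmx_inv.
Qed.

(** The binary octahedral group acts on the octahedral form by a character. The
    transpose appears because the natural action uses [phi2 (t)^T]; it is the
    action on columns of the matrix, which [f1] turns into a substitution in the
    two linear forms. *)
Lemma f1_S4star (A : 'M[C]_2) : S4star A ->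
  exists2 k : C, k != 0 & forall M, f1 (M *m A^T) = k *: f1 M.
Proof.
have N1 : -1 != 0 :> C by rewrite oppr_eq0 oner_eq0.
elim=> {A} [||||].
- by exists (-1) => // M; apply: f1_gen1.
- by exists (-1) => // M; apply: f1_gen2.
- by exists 1 => [|M]; rewrite ?oner_neq0 // trmx1 mulmx1 scale1r.
- move=> A B _ [k k0 hk] _ [l l0 hl]; exists (k * l) => [|M]; first exact: mulf_neq0.
  by rewrite trmx_mul mulmxA hk hl scalerA.
move=> A /S4star_unitmx uA [k k0 hk]; exists k^-1 => [|M]; first by rewrite invr_eq0.
apply: (scalerI k0); rewrite scalerA divff // scale1r -hk -mulmxA -trmx_mul mulmxV //.
by rewrite trmx1 mulmx1.
Qed.
End OctahedralForm.

(** * The composite of f1 with a map, and the natural action *)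

Lemma map_octa (A B : comNzRingType) (h : {rmorphism A -> B}) (a b c d : A) :
  let l1 := a *: 'X_0 - b *: 'X_1 : {mpoly A[2]} in
  let l2 := c *: 'X_1 - d *: 'X_0 in
  let m1 := h a *: 'X_0 - h b *: 'X_1 : {mpoly B[2]} in
  let m2 := h c *: 'X_1 - h d *: 'X_0 in
  map_mpoly h (l1 * l2 * (l1 ^+ 4 - l2 ^+ 4)) = m1 * m2 * (m1 ^+ 4 - m2 ^+ 4).
Proof.
move=> l1 l2 m1 m2.
have e1 : map_mpoly h l1 = m1 by rewrite raddfB /= !map_mpolyZ !map_mpolyX.
have e2 : map_mpoly h l2 = m2 by rewrite raddfB /= !map_mpolyZ !map_mpolyX.
rewrite -e1 -e2; move: l1 l2 {m1 m2 e1 e2} => l1 l2.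
by rewrite !rmorphM rmorphB !rmorphXn.
Qed.

Section Sextic.
Variable R : realType.
Local Notation C := R[i].
Implicit Types (q : 'cV[C]_2).

(** The exponents used by [coords]. *)
Definition sextic_mon (i : 'I_7) : 'X_{1..2} := [multinom [tuple (6 - i)%N; i : nat]].

Lemma coordsZ c (f : binform R 6) : coords (c *: f) = c *: coords f.
Proof. by apply/colP => i; rewrite !mxE mcoeffZ. Qed.

Lemma coords_eq0 (f : binform R 6) : coords f = 0 -> f = 0.
Proof.
move=> /colP f0; apply/val_inj/mpolyP => m /=; rewrite mcoeff0.
have [sm|/memN_msupp_eq0 -> //] := boolP (m \in msupp (f : {mpoly C[2]})).
have em := homog_exp (dhomog_is_dhomog f) sm.
have m1 : (m 1%R < 7)%N by rewrite ltnS -em leq_addl.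
have := f0 (Ordinal m1); rewrite !mxE => f0'.
rewrite -[RHS]f0'; congr (_ @_ _); apply/mnmP; apply: ord2P.
  by rewrite multinomE (tnth_nth 0%N) /= -em addnK.
by rewrite multinomE (tnth_nth 0%N).
Qed.

(** [f1 o g] as a sextic in the target variables whose coefficients are forms
    in the source variables: the nested polynomial ring keeps the two pairs of
    variables apart. *)
Definition f1_poly n (g : 'M[binform R n]_2) : {mpoly {mpoly C[2]}[2]} :=
  let l1 := (g 1 1 : {mpoly C[2]}) *: 'X_0 - (g 0 1 : {mpoly C[2]}) *: 'X_1 in
  let l2 := (g 0 0 : {mpoly C[2]}) *: 'X_1 - (g 1 0 : {mpoly C[2]}) *: 'X_0 in
  l1 * l2 * (l1 ^+ 4 - l2 ^+ 4).

Lemma map_f1_poly n (g : 'M[binform R n]_2) q :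
  map_mpoly (meval (fun i => q i ord0)) (f1_poly g) = f1 (mx_eval g q) :> {mpoly C[2]}.
Proof.
by rewrite [LHS]map_octa /f1 /= !mxE.
Qed.

Definition coef_homog k (p : {mpoly {mpoly C[2]}[2]}) : Prop :=
  forall m, p@_m \is k.-homog.

Lemma coef_homogB k p1 p2 : coef_homog k p1 -> coef_homog k p2 -> coef_homog k (p1 - p2).
Proof. by move=> h1 h2 m; rewrite mcoeffB; apply: rpredB. Qed.

Lemma coef_homogM k1 k2 p1 p2 :
  coef_homog k1 p1 -> coef_homog k2 p2 -> coef_homog (k1 + k2) (p1 * p2).
Proof. by move=> h1 h2 m; rewrite mcoeffM; apply: rpred_sum => i _; apply: dhomogM. Qed.

Lemma coef_homogZX k (a : {mpoly C[2]}) (i : 'I_2) :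
  a \is k.-homog -> coef_homog k (a *: 'X_i).
Proof.
move=> ha m; rewrite mcoeffZ mcoeffX; case: eqP => _; rewrite ?mulr1 //.
by rewrite mulr0 dhomog0.
Qed.

Lemma coef_homog_f1_poly n (g : 'M[binform R n]_2) : coef_homog (6 * n) (f1_poly g).
Proof.
have hlin (a b : binform R n) (i j : 'I_2) :
    coef_homog n ((a : {mpoly C[2]}) *: 'X_i - (b : {mpoly C[2]}) *: 'X_j).
  by apply: coef_homogB; apply: coef_homogZX; apply: dhomog_is_dhomog.
have h4 p : coef_homog n p -> coef_homog (n + (n + (n + n))) (p ^+ 4).
  by move=> hp; rewrite !exprS expr0 mulr1; do 3 !apply: coef_homogM => //.
have -> : (6 * n = n + n + (n + (n + (n + n))))%N by ring.
apply: coef_homogM; first by apply: coef_homogM; apply: hlin.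
by apply: coef_homogB; apply: h4; apply: hlin.
Qed.

(** The map [f1 o g] in coordinates. *)
Definition f1_forms n (g : 'M[binform R n]_2) : 'cV[binform R (6 * n)]_7 :=
  \col_i DHomog (coef_homog_f1_poly g (sextic_mon i)).

Lemma ev_f1_forms n (g : 'M[binform R n]_2) i q :
  ev q (f1_forms g i 0 : {mpoly C[2]}) = coords (f1 (mx_eval g q)) i 0.
Proof. by rewrite !mxE -map_f1_poly mcoeff_map_mpoly. Qed.

Lemma f1Z (c : C) M : f1 (c *: M) = c ^+ 6 *: f1 M.
Proof.
apply/val_inj => /=; rewrite !mxE -!mul_mpolyC.
rewrite !(mpolyCM, rmorphXn) /=; ring.
Qed.

Lemma evalf_ext n (f h : binform R n) : (forall q, evalf f q = evalf h q) -> f = h.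
Proof.
move=> e; apply/val_inj/eqP; rewrite -subr_eq0; apply/eqP/mpoly_eq0_off_origin => q _.
by rewrite mevalB; apply/eqP; rewrite subr_eq0; apply/eqP/e.
Qed.

Lemma evalfD n (f h : binform R n) q : evalf (f + h) q = evalf f q + evalf h q.
Proof. by rewrite /evalf mevalD. Qed.

Lemma evalfZ n c (f : binform R n) q : evalf (c *: f) q = c * evalf f q.
Proof. by rewrite /evalf mevalZ. Qed.

Lemma evalf_natural_act phi1 phi2 n t (g : 'M[binform R n]_2) (i j : 'I_2) q :
  let w := natural_act phi1 phi2 t (row_vector g i) in
  evalf (if j == 0 then w.1 else w.2) q =
  (mx_eval g (invmx (phi1 t) *m q) *m (phi2 t)^T) i j.
Proof.
move: j; apply: ord2P => /=; rewrite evalfD !evalfZ !evalf_lin_subst !mxE sum_ord2 !mxE;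
  by rewrite mulrC [X in _ + X]mulrC.
Qed.

(** The two rows are eigenvectors with the same eigenvalue exactly when [g] is
    equivariant up to that constant, which is how the representation sees the
    lift. *)
Lemma natural_act_rowP phi1 phi2 n t (g : 'M[binform R n]_2) (c : C) :
  (forall i, natural_act phi1 phi2 t (row_vector g i) = c *: row_vector g i) <->
  (forall q, mx_eval g (invmx (phi1 t) *m q) *m (phi2 t)^T = c *: mx_eval g q).
Proof.
split=> [e q|e i].
  apply/matrixP => i j; rewrite -evalf_natural_act e !mxE -evalfZ.
  by move: j; apply: ord2P.
have e' j q : evalf (if j == 0 then (natural_act phi1 phi2 t (row_vector g i)).1
    else (natural_act phi1 phi2 t (row_vector g i)).2) q = c * evalf (g i j) q.
  by rewrite (evalf_natural_act phi1 phi2 t g i j q) e !mxE.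
rewrite [LHS]surjective_pairing; congr pair; apply: evalf_ext => q.
  by rewrite (e' 0 q) -evalfZ.
by rewrite (e' 1 q) -evalfZ.
Qed.

Lemma natural_act_linear phi1 phi2 n t :
  linear (@natural_act R phi1 phi2 n t).
Proof.
move=> a u v; rewrite /natural_act.
have lin (f h : binform R n) : act_form (phi1 t) (a *: f + h) =
    a *: act_form (phi1 t) f + act_form (phi1 t) h.
  by apply: evalf_ext => q; rewrite !(evalf_lin_subst, evalfD, evalfZ).
have comb (x y : C) (p1 p2 q1 q2 : binform R n) :
    x *: (a *: p1 + p2) + y *: (a *: q1 + q2) =
    a *: (x *: p1 + y *: q1) + (x *: p2 + y *: q2).
  by rewrite !scalerDr !scalerA addrACA (mulrC x) (mulrC y).
by congr pair; rewrite /= !lin comb.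
Qed.
End Sextic.

(** * The covering group *)

Section Covering.
Variable R : realType.
Local Notation C := R[i].
Implicit Types (q : 'cV[C]_2).

Lemma SU2_unitmx (A : 'M[C]_2) : SU2 A -> A \in unitmx.
Proof. by case=> _ dA; rewrite unitmxE dA unitr1. Qed.

Lemma unitmx2_neq0 (A : 'M[C]_2) : A \in unitmx -> A != 0.
Proof. by apply: contraTneq => ->; rewrite unitmxE det0 unitr0. Qed.

Lemma proj_eq_scale (V : lmodType C) (v w : V) :
  proj_eq v w -> exists2 c, c != 0 & v = c *: w.
Proof.
case=> v0 _ [c e]; exists c => //; apply: contraNneq v0 => c0.
by rewrite e c0 scale0r.
Qed.

Lemma proj_eq_minors k (v w : 'cV[C]_k) : proj_eq v w ->
  forall i j, v i 0 * w j 0 = v j 0 * w i 0.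
Proof. by case=> _ _ [c ->] i j; rewrite !mxE; ring. Qed.

Lemma cV_neq0_coord k (v : 'cV[C]_k) : v != 0 -> exists j, v j 0 != 0.
Proof.
move=> v0; apply/existsP; apply: contraNT v0; rewrite negb_exists => /forallP v0.
by apply/eqP/colP => i; rewrite mxE; apply/eqP; rewrite -[_ == _]negbK.
Qed.

Lemma minors_proj_eq k (v w : 'cV[C]_k) : v != 0 -> w != 0 ->
  (forall i j, v i 0 * w j 0 = v j 0 * w i 0) -> proj_eq v w.
Proof.
move=> v0 w0 e; split=> //.
have [j wj] := cV_neq0_coord w0.
exists (v j 0 / w j 0); apply/colP => i; rewrite !mxE.
by apply: (mulIf wj); rewrite e mulrAC divfK.
Qed.

Lemma mx_evalZ k l n (F : 'M[binform R n]_(k, l)) (c : C) q :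
  mx_eval F (c *: q) = c ^+ n *: mx_eval F q.
Proof. by apply/matrixP => i j; rewrite !mxE /evalf (evZ _ _ (dhomog_is_dhomog _)). Qed.

Variables (d : nat) (phi : 'cV[binform R d]_2).

Definition phi_entry (i : 'I_2) : {mpoly C[2]} := phi i 0.

Lemma homog_phi_entry i : phi_entry i \is d.-homog.
Proof. exact: dhomog_is_dhomog. Qed.

Lemma phi_atE q : phi_at phi_entry q = mx_eval phi q.
Proof. by apply/colP => i; rewrite !mxE. Qed.

Lemma phi_entry_czf : no_common_factor phi -> common_zero_free phi_entry.
Proof.
move=> /no_common_factorP czf q q0; have [[i j] z] := czf q q0; exists i.
by move: z; rewrite /entries /= [j]ord1.
Qed.

Lemma covering_transf_semi_invariant A : no_common_factor phi -> covering_transf phi A ->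
  exists2 c : C, c != 0 & forall i q, ev (A *m q) (phi_entry i) = c * ev q (phi_entry i).
Proof.
move=> ncf [uA hA]; apply: (deck_scale homog_phi_entry (phi_entry_czf ncf) uA).
by move=> q q0 i j; have := proj_eq_minors (hA q q0) i j; rewrite !mxE.
Qed.

Lemma covering_transf_scale A B (c : C) : c != 0 -> A = c *: B ->
  no_common_factor phi -> covering_transf phi A -> covering_transf phi B.
Proof.
move=> c0 eA ncf [uA hA].
have uB : B \in unitmx by move: uA; rewrite eA unitmxZ // unitfE.
split=> // q q0; have [_ w0 [k ek]] := hA q q0.
split=> //; first exact/mx_eval_neq0/unitmx_mul_neq0.
exists ((c ^+ d)^-1 * k); rewrite -scalerA -ek eA -scalemxAl mx_evalZ scalerA.
by rewrite mulVf ?scale1r // expf_neq0.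
Qed.

Hypothesis hphi : galois_covering phi.
Hypothesis hG : covering_group_in_SO3 phi.
Variable phi1 : 'M[C]_2 -> 'M[C]_2.
Hypothesis hphi1 : covers_action phi phi1.

(** Every covering transformation is realized, up to scale, by [phi1] of an
    element of the binary group, because it is represented in SU(2) and [phi1]
    covers the tautological action. *)
Lemma deck_from_binary_group A : covering_transf phi A ->
  exists2 t, binary_group phi t & exists2 c : C, c != 0 & A = c *: phi1 t.
Proof.
move=> hA; have [B SB /proj_eq_scale [b b0 eb]] := hG hA.
have [_ ncf _] := hphi.
have bB : binary_group phi B by split=> //; apply: covering_transf_scale eb ncf hA.
have [_ /(_ B bB) /proj_eq_scale [a a0 ea]] := hphi1.
exists B => //; exists (b / a); first by rewrite mulf_neq0 ?invr_eq0.
by rewrite ea scalerA divfK.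
Qed.

Lemma phi1_unitmx t : binary_group phi t -> phi1 t \in unitmx.
Proof. by move=> ht; have [[h _ _] _] := hphi1; apply/SU2_unitmx/h. Qed.

(** Matrix representatives of the covering group, in the form in which the
    descent takes them. *)
Lemma galois_deck_data : exists (s : 'I_d -> 'M[C]_2) (c : 'I_d -> C),
  [/\ forall k, s k \in unitmx, forall k l a, s l = a *: s k -> k = l,
      forall k, c k != 0, forall i, semi_invariant s c (phi_entry i) &
      forall k, covering_transf phi (s k)].
Proof.
have [_ ncf [s [hs s_inj _]]] := hphi.
have /fin_all_exists2 [c c0 hc] k := covering_transf_semi_invariant ncf (hs k).
have us k : s k \in unitmx by case: (hs k).
exists s, c; split=> // [k l a e|i k q]; last exact: hc.
by apply/esym/s_inj; split; [apply/unitmx2_neq0|apply/unitmx2_neq0|exists a].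
Qed.
End Covering.

(** * Invariant rows give a curve *)

Lemma linear_scalable (K : fieldType) (V W : lmodType K) (h : V -> W) :
  linear h -> scalable h.
Proof.
move=> lin a v; have h0 : h 0 = 0.
  have := lin 1 0 0; rewrite !scale1r addr0 => /eqP.
  by rewrite -subr_eq0 opprD addrA subrr sub0r oppr_eq0 => /eqP.
by rewrite -[a *: v]addr0 lin h0 addr0.
Qed.

Lemma col_scaleE (K : comNzRingType) k (a : K) (v : 'cV[K]_k) i :
  (a *: v) i 0 = a * v i 0.
Proof. by rewrite mxE. Qed.

Section Converse.
Variable R : realType.
Local Notation C := R[i].
Implicit Types (q : 'cV[C]_2).
Variables (d : nat) (phi : 'cV[binform R d]_2).
Hypothesis hphi : galois_covering phi.
Hypothesis hG : covering_group_in_SO3 phi.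
Variable phi1 : 'M[C]_2 -> 'M[C]_2.
Hypothesis hphi1 : covers_action phi phi1.

(** Equivariance of [g], homogeneity of [f1] and the invariance of the
    octahedral form combine into a single constant. It can be moved to the
    other side because [f1 o g] is not identically zero, which forces [c] to be
    nonzero. *)
Lemma f1_lift_semi_invariant n (g : 'M[binform R n]_2) phi2 t (c : C) :
  phi1 t \in unitmx -> S4star (phi2 t) ->
  (forall i, natural_act phi1 phi2 t (row_vector g i) = c *: row_vector g i) ->
  (exists q, f1 (mx_eval g q) != 0) ->
  exists a : C, forall q i,
    coords (f1 (mx_eval g (phi1 t *m q))) i 0 = a * coords (f1 (mx_eval g q)) i 0.
Proof.
move=> u1 S2 /natural_act_rowP inv [q0 fq0].
have [k k0 hk] := f1_S4star S2.
have e q : k *: f1 (mx_eval g q) = c ^+ 6 *: f1 (mx_eval g (phi1 t *m q)).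
  by rewrite -f1Z -hk -inv mulKmx.
have c0 : c ^+ 6 != 0.
  apply: contraNneq fq0 => c0; have := e q0; rewrite c0 scale0r.
  by move/eqP; rewrite scaler_eq0 (negPf k0).
exists (c ^- 6 * k) => q i; rewrite -col_scaleE -coordsZ -scalerA e scalerA mulVf //.
by rewrite scale1r.
Qed.

Lemma f1_forms_neq0 n (g : 'M[binform R n]_2) q : f1 (mx_eval g q) != 0 ->
  exists i, (f1_forms g i 0 : {mpoly C[2]}) != 0.
Proof.
move=> fq; have [|i z] := @cV_neq0_coord _ _ (coords (f1 (mx_eval g q))).
  by apply: contraNneq fq => /coords_eq0 ->.
by exists i; apply: contraNneq z => z; rewrite -ev_f1_forms z meval0.
Qed.

(** The coefficients of [f1 o g] are semi-invariant with common multipliers, so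
    they descend to forms on the target of [phi]. *)
Lemma lift_of_invariant_rows n (g : 'M[binform R n]_2) phi2 :
  inj_hom (binary_group phi) (@S4star R) phi2 ->
  (forall t, binary_group phi t -> exists c : C, forall i,
     natural_act phi1 phi2 t (row_vector g i) = c *: row_vector g i) ->
  (exists2 q, q != 0 & f1 (mx_eval g q) != 0) ->
  exists (m : nat) (F : 'cV[binform R m]_7),
    [/\ no_common_factor F, f1_lift phi g F
      & forall (m' : nat) (F' : 'cV[binform R m']_7),
          no_common_factor F' -> f1_lift phi g F' ->
          forall p, p != 0 -> proj_eq (mx_eval F' p) (mx_eval F p)].
Proof.
move=> [S2 _ _] inv [q0 q0_0 fq0].
have [d0 ncf _] := hphi.
have [s [c [us s_inj c0 phi_semi hs]]] := galois_deck_data hphi.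
have czf := phi_entry_czf ncf.
pose e i : {mpoly C[2]} := f1_forms g i 0.
have he i : e i \is (6 * n).-homog by apply: dhomog_is_dhomog.
have ev_e i q : ev q (e i) = coords (f1 (mx_eval g q)) i 0 by apply: ev_f1_forms.
have e0 : exists i, e i != 0 by apply: f1_forms_neq0 fq0.
have semi_k k : exists a : C, forall i q, ev (s k *m q) (e i) = a * ev q (e i).
  have [t ht [b b0 eb]] := deck_from_binary_group hphi hG hphi1 (hs k).
  have [ct hct] := inv t ht.
  have [|a ha] := f1_lift_semi_invariant (phi1_unitmx hphi1 ht) (S2 t ht) hct.
    by exists q0.
  exists (b ^+ (6 * n) * a) => i q.
  rewrite eb -scalemxAl (evZ _ _ (he i)) !ev_e -mulrA; congr (_ * _).
  exact: ha.
have {semi_k} [chi hchi] := fin_all_exists semi_k.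
have se i : semi_invariant s chi (e i) by move=> k q; apply: hchi.
have homp := homog_phi_entry phi.
have [m [F [hF zF eF]]] := invariant_map_descends d0 homp czf us s_inj c0 phi_semi he e0 se.
pose Fc : 'cV[binform R m]_7 := \col_i DHomog (hF i).
have ncF : no_common_factor Fc.
  apply/no_common_factorP => q qn0; have [i z] := zF q qn0.
  by exists (i, 0); rewrite /entries /= mxE.
have Fc_ev p i : mx_eval Fc p i 0 = ev p (F i) by rewrite !mxE.
exists m, Fc; split=> //.
  split; first by exists q0.
  move=> q qn0 fq; apply: minors_proj_eq.
  - by apply: contraNneq fq => z; apply/eqP/coords_eq0.
  - by apply: mx_eval_neq0 => //; rewrite -phi_atE; apply: (phi_at_neq0 czf).
  - by move=> i j; rewrite !Fc_ev -phi_atE -!ev_e eF.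
move=> m' F' ncF' [_ lF'] p p0.
pose F'e i : {mpoly C[2]} := F' i 0.
have hF' i : F'e i \is m'.-homog by apply: dhomog_is_dhomog.
have eF' q i j : q != 0 -> ev q (e i) * ev (phi_at (phi_entry phi) q) (F'e j) =
    ev q (e j) * ev (phi_at (phi_entry phi) q) (F'e i).
  move=> qn0; rewrite !ev_e phi_atE; have [->|fq] := eqVneq (f1 (mx_eval g q)) 0.
    by rewrite !mxE !mcoeff0 !mul0r.
  have := proj_eq_minors (lF' q qn0 fq) i j.
  by rewrite [mx_eval F' _ j 0]mxE [mx_eval F' _ i 0]mxE.
have mF := descent_unique d0 homp czf e0 hF hF' (fun q i j _ => eF q i j) eF'.
apply: minors_proj_eq; try exact: mx_eval_neq0.
move=> i j; rewrite !Fc_ev [mx_eval F' p i 0]mxE [mx_eval F' p j 0]mxE.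
have := congr1 (meval (fun i => p i ord0)) (mF i j); rewrite !mevalM => h.
by rewrite mulrC [RHS]mulrC h.
Qed.

(** On a line [t] acts by a scalar, and an isomorphism transports that scalar
    from [W] to every summand. *)
Lemma isotypic_scalar n (W : vectType C) (rhoW : 'M[C]_2 -> W -> W) k phi2
    (U : 'I_k -> {vspace binform R n * binform R n}) t :
  let rho := @natural_act R phi1 phi2 n in
  is_rep (binary_group phi) rhoW -> one_dim_irrep (binary_group phi) rhoW {: W} ->
  (forall i, one_dim_irrep (binary_group phi) rho (U i) /\
             rep_iso (binary_group phi) rho (U i) rhoW {: W}) ->
  binary_group phi t ->
  exists c : C, {in (\sum_(i < k) U i)%VS, forall w, rho t w = c *: w}.
Proof.
move=> rho [linW _ _] [dimW _] hU ht.
have fullW : {:W}%VS = <[vpick {:W}]>%VS.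
  apply/esym/eqP; rewrite eqEdim subvf dim_vline dimW.
  by rewrite vpick0 -dimv_eq0 dimW.
have /vlineP [c ec] : rhoW t (vpick {:W}) \in <[vpick {:W}]>%VS.
  by rewrite -fullW memvf.
have rhoWE w : rhoW t w = c *: w.
  have /vlineP [a ->] : w \in <[vpick {:W}]>%VS by rewrite -fullW memvf.
  by rewrite (linear_scalable (linW t ht)) ec !scalerA mulrC.
have rhoU i : {in U i, forall w, rho t w = c *: w}.
  move=> w Uw; have [[_ [sub _ _]] [f [finj _ feq]]] := hU i.
  by apply: finj; rewrite ?memvZ ?sub // feq // rhoWE linearZ.
exists c => w /memv_sumP [u hu ->].
have lin := @natural_act_linear R phi1 phi2 n t.
have rho0 : rho t 0 = 0 by have := linear_scalable lin 0 0; rewrite !scale0r.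
have rhoD : {morph rho t : x y / x + y}.
  by move=> x y; have := lin 1 x y; rewrite !scale1r.
rewrite (big_morph _ rhoD rho0) scaler_sumr; apply: eq_bigr => i _.
exact/rhoU/hu.
Qed.
End Converse.

(** * Singular matrices and the orbit of u^5v *)

Lemma ev_octa_lines (K : closedFieldType) (a b c e : K) (q : 'cV[K]_2) :
  let l1 := a *: 'X_0 - b *: 'X_1 : {mpoly K[2]} in
  let l2 := c *: 'X_1 - e *: 'X_0 in
  let x := a * q 0 0 - b * q 1 0 in let y := c * q 1 0 - e * q 0 0 in
  ev q (l1 * l2 * (l1 ^+ 4 - l2 ^+ 4)) = x * y * (x ^+ 4 - y ^+ 4).
Proof.
move=> l1 l2 x y.
have e1 : ev q l1 = x by rewrite mevalB !mevalZ !mevalXU.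
have e2 : ev q l2 = y by rewrite mevalB !mevalZ !mevalXU.
rewrite -e1 -e2; move: l1 l2 {x y e1 e2} => l1 l2.
by rewrite !mevalM mevalB !rmorphXn.
Qed.

Lemma ev_X0X1 (K : closedFieldType) (q : 'cV[K]_2) :
  ev q ('X_0 ^+ 5 * 'X_1) = q 0 0 ^+ 5 * q 1 0.
Proof. by rewrite mevalM rmorphXn /= !mevalXU. Qed.

Section Direct.
Variable R : realType.
Local Notation C := R[i].
Implicit Types (q : 'cV[C]_2).

Lemma ev_f1 (M : 'M[C]_2) q :
  let x := M 1 1 * q 0 0 - M 0 1 * q 1 0 in
  let y := M 0 0 * q 1 0 - M 1 0 * q 0 0 in
  evalf (f1 M) q = x * y * (x ^+ 4 - y ^+ 4).
Proof. exact: ev_octa_lines. Qed.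

Lemma coords_addZ (f h : binform R 6) (s : C) i :
  coords (f + s *: h) i 0 = coords f i 0 + s * coords h i 0.
Proof. by rewrite !mxE mcoeffD mcoeffZ. Qed.

(** (a u + b v)^5 (c u + e v). *)
Definition u5v_subst (a b c e : C) : binform R 6 :=
  lin_subst (\matrix_(i, j) (if i == 0 then if j == 0 then a else b
                             else if j == 0 then c else e)) (u5v R).

Lemma ev_u5v_subst a b c e q : evalf (u5v_subst a b c e) q =
  (a * q 0 0 + b * q 1 0) ^+ 5 * (c * q 0 0 + e * q 1 0).
Proof.
by rewrite evalf_lin_subst [LHS]ev_X0X1 !mxE !sum_ord2 !mxE.
Qed.

Lemma u5v_subst_in_orbit a b c e : a * e - b * c = 1 ->
  exists2 A : 'M[C]_2, \det A = 1 & act_form A (u5v R) = u5v_subst a b c e.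
Proof.
move=> d1; set B : 'M[C]_2 := \matrix_(i, j) (if i == 0 then if j == 0 then a else b
                             else if j == 0 then c else e).
have dB : \det B = 1 by rewrite det_mx2 !mxE /=.
by exists (invmx B); rewrite ?det_inv ?dB ?invr1 // /act_form invmxK.
Qed.

(** With [l = a u + b v] and [l'] such that [l, l'] has determinant 1, the
    forms [l^5 (l + s l')] are multiples of points of the orbit for nonzero [s].
    An equation of the orbit therefore vanishes on them, hence also at [s = 0]. *)
Lemma u5v_closure_sixth_power (a b k : C) : (a != 0) || (b != 0) -> k != 0 ->
  in_orbit_closure (u5v R) (coords (k *: u5v_subst a b a b)).
Proof.
move=> ab0 k0.
have [c [e ce]] : exists c e, a * e - b * c = 1.
  case/orP: ab0 => z; [exists 0, a^-1|exists (- b^-1), 0].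
    by rewrite mulr0 subr0 divff.
  by rewrite mulr0 sub0r mulrN opprK divff.
have split_s s : u5v_subst a b (a + s * c) (b + s * e) =
    u5v_subst a b a b + s *: u5v_subst a b c e.
  by apply: evalf_ext => q; rewrite evalfD evalfZ !ev_u5v_subst; ring.
split.
  apply/eqP => /coords_eq0 /eqP; rewrite scaler_eq0 (negPf k0) /= => /eqP z.
  have ev0 q : a * q 0 0 + b * q 1 0 = 0.
    have := ev_u5v_subst a b a b q; rewrite z /evalf meval0 -exprSr => /esym/eqP.
    by rewrite expf_eq0 => /eqP.
  have := ev0 (pt 1 0); have := ev0 (pt 0 1).
  rewrite !pt_0 !pt_1 !mulr0 !mulr1 addr0 add0r => b0 a0.
  by move: ab0; rewrite a0 b0 eqxx.
move=> n P van.
have step s : s != 0 ->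
    (P : {mpoly C[7]}).@[fun i => coords (u5v_subst a b a b) i 0 +
       s * coords (u5v_subst a b c e) i 0] = 0.
  move=> s0.
  (* Dividing the second linear form by s normalizes the determinant to 1. *)
  have [|A dA eA] := @u5v_subst_in_orbit a b ((a + s * c) / s) ((b + s * e) / s).
    rewrite -[RHS]ce; field; exact: s0.
  have eF : u5v_subst a b (a + s * c) (b + s * e) = s *: act_form A (u5v R).
    rewrite eA; apply: evalf_ext => q; rewrite evalfZ !ev_u5v_subst; field; exact: s0.
  rewrite -(mulr0 (s ^+ n)) -[in RHS](van A dA).
  rewrite -(meval_homog _ _ (dhomog_is_dhomog P)).
  apply: meval_eq => i; have <- := coords_addZ (u5v_subst a b a b) (u5v_subst a b c e) s i.
  by rewrite -split_s eF coordsZ col_scaleE.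
have P0 : (P : {mpoly C[7]}).@[fun i => coords (u5v_subst a b a b) i 0] = 0.
  pose u := restrict_to_line (fun i => coords (u5v_subst a b a b) i 0)
    (fun i => coords (u5v_subst a b c e) i 0) (P : {mpoly C[7]}).
  have u0 : u = 0.
    (* The factor 'X disposes of s = 0, where [step] says nothing. *)
    apply: (mulfI (negbT (polyX_eq0 C))); rewrite mulr0; apply: poly_eq0_horner => s.
    rewrite hornerM hornerX; have [->|s0] := eqVneq s 0; first by rewrite mul0r.
    by rewrite horner_restrict_to_line step // mulr0.
  have := horner_restrict_to_line (fun i => coords (u5v_subst a b a b) i 0)
    (fun i => coords (u5v_subst a b c e) i 0) (P : {mpoly C[7]}) 0.
  rewrite -/u u0 horner0 => z; rewrite [RHS]z; apply: meval_eq => i.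
  by rewrite mul0r addr0.
rewrite -(mulr0 (k ^+ n)) -P0 -(meval_homog _ _ (dhomog_is_dhomog P)).
by apply: meval_eq => i; rewrite coordsZ col_scaleE.
Qed.

(** When [M] is singular the two linear forms in [f1 M] are proportional, so
    [f1 M] is a multiple of a sixth power. *)
Lemma f1_singular (M : 'M[C]_2) : \det M = 0 -> f1 M != 0 ->
  in_orbit_closure (u5v R) (coords (f1 M)).
Proof.
rewrite det_mx2 => dM fM.
have ab0 : (M 1 1 != 0) || (- M 0 1 != 0).
  rewrite oppr_eq0 -negb_and; apply: contraNN fM => /andP[/eqP z1 /eqP z2].
  apply/eqP/evalf_ext => q; rewrite ev_f1 z1 z2 /evalf meval0; ring.
have [c c1 c2] : exists2 c, - M 1 0 = c * M 1 1 & M 0 0 = - (c * M 0 1).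
  case/orP: ab0 => z; [exists (- M 1 0 / M 1 1)|exists (- M 0 0 / M 0 1)].
  - by rewrite divfK.
  - apply: (mulIf z); move/eqP: dM; rewrite subr_eq0 => /eqP ->; field; exact: z.
  - rewrite oppr_eq0 in z; apply: (mulfI z); rewrite mulrN.
    by move/eqP: dM; rewrite subr_eq0 => /eqP <-; field; exact: z.
  - by rewrite oppr_eq0 in z; rewrite divfK // opprK.
have ef : f1 M = (c - c ^+ 5) *: u5v_subst (M 1 1) (- M 0 1) (M 1 1) (- M 0 1).
  apply: evalf_ext => q; rewrite evalfZ ev_u5v_subst ev_f1.
  have -> : M 0 0 * q 1 0 - M 1 0 * q 0 0 = c * (M 1 1 * q 0 0 - M 0 1 * q 1 0).
    have c3 : M 1 0 = - (c * M 1 1) by rewrite -c1 opprK.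
    by rewrite c2 c3; ring.
  ring.
rewrite ef; apply: u5v_closure_sixth_power => //.
by apply: contraNneq fM; rewrite ef => ->; rewrite scale0r.
Qed.
End Direct.

(** * The rows of a lift *)

Lemma mulmx_inv_scaled (K : fieldType) (X Y B : 'M[K]_2) (c : K) :
  X \in unitmx -> Y \in unitmx -> c != 0 -> B = c *: (invmx X *m Y) ->
  X *m B = c *: Y /\ X *m B != 0.
Proof.
move=> uX uY c0 ->; rewrite -scalemxAr mulKVmx //; split=> //.
rewrite scaler_eq0 negb_or c0; apply: contraTneq uY => ->.
by rewrite unitmxE det0 unitr0.
Qed.

Section DirectPart.
Variable R : realType.
Local Notation C := R[i].
Implicit Types (q : 'cV[C]_2).

(** If [det g] vanished identically, an equation [P] of the orbit of [u^5 v]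
    would vanish on the curve at the points [phi q], and these are all points. *)
Lemma lift_generically_invertible d n (phi : 'cV[binform R d]_2)
    (F : 'cV[binform R 6]_7) (g : 'M[binform R n]_2) :
  (0 < d)%N -> no_common_factor phi -> sextic_curve F -> f1_lift phi g F ->
  exists q, \det (mx_eval g q) != 0.
Proof.
move=> d0 ncf [ncF _ _ [p p0 pF]] [[q0 q0_0 fq0] hF].
apply: contrapT => sing; apply: pF.
have dg q : \det (mx_eval g q) = 0.
  by apply/eqP/negP => /negP dq; apply: sing; exists q.
split; first exact: mx_eval_neq0.
move=> e P van.
have czf := phi_entry_czf ncf.
have homp := homog_phi_entry phi.
pose PF : {mpoly C[2]} := (P : {mpoly C[7]}) \mPo [tuple (F i 0 : {mpoly C[2]}) | i < 7].
have evPF (r : 'cV[C]_2) : ev r PF = (P : {mpoly C[7]}).@[fun i => mx_eval F r i 0].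
  by rewrite comp_mpoly_meval; apply: meval_eq => i; rewrite tnth_mktuple mxE.
have PFZ (r : 'cV[C]_2) (c : C) : ev (c *: r) PF = c ^+ 6 ^+ e * ev r PF.
  rewrite !evPF -(meval_homog _ _ (dhomog_is_dhomog P)).
  by apply: meval_eq => i; rewrite mx_evalZ col_scaleE.
have [i0 ei0] := f1_forms_neq0 fq0.
have PFphi : PF \mPo [tuple phi_entry phi i | i < 2] = 0.
  (* The factor disposes of the points where f1 o g is undefined. *)
  apply: (mulIf ei0); rewrite mul0r; apply: mpoly_eq0_off_origin => q qn0.
  rewrite mevalM ev_f1_forms; have [->|fq] := eqVneq (f1 (mx_eval g q)) 0.
    by rewrite mxE mcoeff0 mulr0.
  have [_ hc] := f1_singular (dg q) fq.
  have [_ _ [c ec]] := hF q qn0 fq.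
  have Fq0 : mx_eval F (mx_eval phi q) != 0.
    by apply: mx_eval_neq0 => //; apply: mx_eval_neq0.
  have [c' ec'] : exists c', mx_eval F (mx_eval phi q) = c' *: coords (f1 (mx_eval g q)).
    exists c^-1; rewrite ec scalerA mulVf ?scale1r //.
    by apply: contraNneq fq => c0; apply/eqP/coords_eq0; rewrite ec c0 scale0r.
  rewrite ev_comp -/(phi_at _ q) phi_atE evPF ec'.
  rewrite (meval_eq (v2 := fun i => c' * coords (f1 (mx_eval g q)) i 0)); last first.
    by move=> i; rewrite col_scaleE.
  by rewrite (meval_homog _ _ (dhomog_is_dhomog P)) (hc e P van) mulr0 mul0r.
have [q qn0 [c c0 ec]] := phi_at_surj d0 homp czf p0.
have := ev_comp (phi_entry phi) PF q.
rewrite PFphi meval0 -/(phi_at _ q) ec PFZ => /esym/eqP.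
by rewrite mulf_eq0 !expf_eq0 (negPf c0) !andbF /= => /eqP <-; rewrite evPF.
Qed.

Lemma ev_entries k l n (F : 'M[binform R n]_(k, l)) ij q :
  ev q (entries F ij) = mx_eval F q ij.1 ij.2.
Proof. by rewrite mxE. Qed.

Definition det_form n (g : 'M[binform R n]_2) : {mpoly C[2]} :=
  (g 0 0 : {mpoly C[2]}) * (g 1 1 : {mpoly C[2]}) -
  (g 0 1 : {mpoly C[2]}) * (g 1 0 : {mpoly C[2]}).

Lemma ev_det_form n (g : 'M[binform R n]_2) q :
  ev q (det_form g) = \det (mx_eval g q).
Proof. by rewrite det_mx2 !mxE mevalB !mevalM. Qed.

Lemma linform_subst_neq0 (A : 'M[C]_2) f :
  A \in unitmx -> f != 0 -> linform_subst A f != 0.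
Proof.
move=> uA /mpoly_neq0_ev [q _]; apply: contraNneq => z.
have := ev_linform_subst A f (invmx A *m q).
by rewrite z meval0 mulKVmx // => <-.
Qed.

Definition mulmx_forms n (g : 'M[binform R n]_2) (B : 'M[C]_2) : 'M[binform R n]_2 :=
  \matrix_(i, j) (B 0 j *: g i 0 + B 1 j *: g i 1).

Lemma mx_eval_mulmx_forms n (g : 'M[binform R n]_2) B q :
  mx_eval (mulmx_forms g B) q = mx_eval g q *m B.
Proof.
apply/matrixP => i j; rewrite !mxE sum_ord2 !mxE evalfD !evalfZ.
by rewrite mulrC [X in _ + X]mulrC.
Qed.

(** Proportionality at generic points becomes proportionality by a constant
    [c]; the eigenvalue of the natural action is its inverse, since that action
    precomposes with the inverse of [phi1 t]. *)
Lemma rows_semi_invariant n (g : 'M[binform R n]_2) phi1 phi2 (t : 'M[C]_2) :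
  no_common_factor g -> (exists q, \det (mx_eval g q) != 0) ->
  phi1 t \in unitmx -> phi2 t \in unitmx ->
  (forall q, mx_eval g q \in unitmx -> mx_eval g (phi1 t *m q) \in unitmx ->
     proj_eq (invmx (phi2 t))^T (deck_quot g (phi1 t) q)) ->
  exists c : C, forall i,
    natural_act phi1 phi2 t (row_vector g i) = c *: row_vector g i.
Proof.
move=> ncf [r dr] u1 u2 hdet.
set B := (invmx (phi2 t))^T in hdet.
have [H eH] : exists H : 'M[binform R n]_2,
    forall q, mx_eval H q = mx_eval g (phi1 t *m q) *m B.
  exists (mulmx_forms (\matrix_(i, j) lin_subst (phi1 t) (g i j)) B) => q.
  rewrite mx_eval_mulmx_forms; congr (_ *m _).
  by apply/matrixP => i j; rewrite !mxE evalf_lin_subst.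
have D0 : det_form g != 0 by apply: contraNneq dr => z; rewrite -ev_det_form z meval0.
have generic q : ev q (det_form g) != 0 ->
    ev q (linform_subst (phi1 t) (det_form g)) != 0 ->
    exists2 c, mx_eval H q = c *: mx_eval g q & mx_eval H q != 0.
  rewrite ev_linform_subst !ev_det_form -!unitfE -!unitmxE => uq uq'.
  have [c c0 ec] := proj_eq_scale (hdet q uq uq').
  have [e1 e2] := mulmx_inv_scaled uq' uq c0 ec.
  by exists c; rewrite eH.
have E0 := mulf_neq0 D0 (linform_subst_neq0 u1 D0).
have [q z|c ec] := homog_proportional_generic (homog_entries g) (homog_entries H)
    (proj1 (no_common_factorP g) ncf) E0.
  move: z; rewrite mevalM mulf_eq0 negb_or => /andP[z1 z2].
  have [c ec _] := generic q z1 z2.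
  by exists c => ij; rewrite !ev_entries ec mxE.
have eHg q : mx_eval H q = c *: mx_eval g q.
  apply/matrixP => i j; rewrite -[LHS](ev_entries H (i, j) q).
  by rewrite ec mevalZ ev_entries [RHS]mxE.
have c0 : c != 0.
  have [q _ z] := mpoly_neq0_ev E0; move: z.
  rewrite mevalM mulf_eq0 negb_or => /andP[z1 z2].
  have [_ _] := generic q z1 z2; rewrite eHg; apply: contraNneq => ->.
  by rewrite scale0r.
exists c^-1; apply/natural_act_rowP => q.
apply: (scalerI c0); rewrite scalerA divff // scale1r scalemxAl -eHg eH mulKVmx //.
by rewrite -mulmxA -trmx_mul mulmxV // trmx1 mulmx1.
Qed.
End DirectPart.

Section Lines.
Variables (K : fieldType) (V : vectType K).
Implicit Types (v w : V).

(** A linear endomorphism sending [v] to [w]; it gives the isomorphism between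
    the two lines. *)
Definition line_map v w (u : V) : V := coord [tuple v] ord0 u *: w.

Lemma line_map_linear v w : linear (line_map v w).
Proof. by move=> a x y; rewrite /line_map linearP scalerDl scalerA. Qed.

HB.instance Definition _ v w :=
  GRing.isLinear.Build K V V *:%R (line_map v w) (line_map_linear v w).

Lemma linfun_line_map v w : v != 0 -> linfun (line_map v w) v = w.
Proof.
move=> v0; rewrite lfunE /= /line_map.
have fv : free [tuple v] by rewrite seq1_free.
by rewrite (coord_free ord0 ord0 fv) scale1r.
Qed.

Variables (m : nat) (S : 'M[K]_m -> Prop) (rho : 'M[K]_m -> V -> V).
Hypothesis rho_lin : forall t, S t -> scalable (rho t).

Lemma one_dim_irrep_line v : v != 0 ->
  (forall t, S t -> exists c, rho t v = c *: v) -> one_dim_irrep S rho <[v]>.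
Proof.
move=> v0 hv; have d1 : \dim <[v]> = 1%N by rewrite dim_vline v0.
split=> //; split.
- move=> t /[dup] St /hv [c ec] w /vlineP [a ->].
  by rewrite rho_lin // ec !memvZ ?memv_line.
- by rewrite -dimv_eq0 d1.
move=> U' sU _; have := dimvS sU; rewrite d1 leq_eqVlt ltnS leqn0 dimv_eq0.
case/orP => /eqP dU; [right|by left].
by apply/eqP; rewrite eqEdim sU d1 dU.
Qed.

Lemma rep_iso_lines v w : v != 0 -> w != 0 ->
  (forall t, S t -> exists c, rho t v = c *: v /\ rho t w = c *: w) ->
  rep_iso S rho <[v]> rho <[w]>.
Proof.
move=> v0 w0 h; exists (linfun (line_map v w)).
have fv := linfun_line_map w v0.
split.
- move=> _ _ /vlineP [a ->] /vlineP [b ->]; rewrite !linearZ /= fv => /eqP.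
  by rewrite -subr_eq0 -scalerBl scaler_eq0 (negPf w0) orbF subr_eq0 => /eqP ->.
- by rewrite limg_line fv.
move=> t /[dup] St /h [c [ev_ ew]] _ /vlineP [a ->].
by rewrite rho_lin // ev_ !linearZ /= fv rho_lin // ew.
Qed.

Lemma directv_lines v w :
  (forall a b, a *: v = b *: w -> a = 0) -> directv (<[v]> + <[w]>).
Proof.
move=> h; apply/directv_addP/eqP; rewrite -subv0; apply/subvP => u.
rewrite memv_cap => /andP[/vlineP [a ea] /vlineP [b eb]].
by rewrite ea (h a b) -?ea // scale0r mem0v.
Qed.
End Lines.

Theorem theorem3p1 (R : realType) (d : nat) (phi : 'cV[binform R d]_2)
    (hphi : galois_covering phi) (hG : covering_group_in_SO3 phi)
    (phi1 : 'M[R[i]]_2 -> 'M[R[i]]_2) (hphi1 : covers_action phi phi1) :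
  (forall (n : nat) (F : 'cV[binform R 6]_7) (g : 'M[binform R n]_2)
      (phi2 : 'M[R[i]]_2 -> 'M[R[i]]_2),
    sextic_curve F ->
    rational_galois_lift phi F g ->
    inj_hom (binary_group phi) (@S4star R) phi2 ->
    determined_by_lift phi g phi1 phi2 ->
    let rho := @natural_act R phi1 phi2 n in
    let L0 := <[row_vector g 0%R]>%VS in
    let L1 := <[row_vector g 1%R]>%VS in
    [/\ one_dim_irrep (binary_group phi) rho L0,
        one_dim_irrep (binary_group phi) rho L1,
        rep_iso (binary_group phi) rho L0 rho L1
      & directv (L0 + L1)])
  /\
  (forall (n k : nat) (phi2 : 'M[R[i]]_2 -> 'M[R[i]]_2)
      (W : vectType R[i]) (rhoW : 'M[R[i]]_2 -> W -> W)
      (U : 'I_k -> {vspace binform R n * binform R n}) (g : 'M[binform R n]_2),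
    (2 <= k)%N ->
    inj_hom (binary_group phi) (@S4star R) phi2 ->
    let rho := @natural_act R phi1 phi2 n in
    is_rep (binary_group phi) rhoW ->
    one_dim_irrep (binary_group phi) rhoW {: W} ->
    (forall i, one_dim_irrep (binary_group phi) rho (U i) /\
               rep_iso (binary_group phi) rho (U i) rhoW {: W}) ->
    directv (\sum_(i < k) U i) ->
    (forall i, row_vector g i \in (\sum_(j < k) U j)%VS) ->
    free [:: row_vector g 0; row_vector g 1] ->
    (exists2 q : 'cV[R[i]]_2, q != 0 & f1 (mx_eval g q) != 0) ->
    exists (m : nat) (F : 'cV[binform R m]_7),
      [/\ no_common_factor F, f1_lift phi g F
        & forall (m' : nat) (F' : 'cV[binform R m']_7),
            no_common_factor F' -> f1_lift phi g F' ->
            forall p, p != 0 -> proj_eq (mx_eval F' p) (mx_eval F p)]).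
Proof.
split=> [n F g phi2 hF [ncg lift _] [S2 _ _] hdet rho L0 L1|].
  have [d0 ncf _] := hphi.
  have [r dr] := lift_generically_invertible d0 ncf hF lift.
  have inv t : binary_group phi t ->
      exists c, forall i, rho t (row_vector g i) = c *: row_vector g i.
    move=> ht; apply: rows_semi_invariant => //; first by exists r.
    - exact: (phi1_unitmx hphi1 ht).
    - exact/S4star_unitmx/S2.
    - by move=> q; apply: hdet.
  have indep (i j : 'I_2) a b :
      i != j -> a *: row_vector g i = b *: row_vector g j -> a = 0.
    move=> ij e; apply/eqP; apply: contraNT dr => a0; apply/eqP.
    have ek : forall k, a *: g i k = b *: g j k.
      by apply: ord2P; [apply: (congr1 fst e)|apply: (congr1 snd e)].
    have ev0 k : a * mx_eval g r i k = b * mx_eval g r j k.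
      by rewrite [mx_eval g r i k]mxE [mx_eval g r j k]mxE -!evalfZ ek.
    apply: (mulfI a0); rewrite mulr0 det_mx2.
    have : a * (mx_eval g r i 0 * mx_eval g r j 1 - mx_eval g r i 1 * mx_eval g r j 0) = 0.
      by rewrite mulrBr !mulrA !ev0; ring.
    move: i j ij {e ek ev0}; apply: ord2P; apply: ord2P => //= _ h.
    rewrite -[RHS]oppr0 -h; ring.
  have row0 (i : 'I_2) : row_vector g i != 0.
    apply/eqP => z; have [j ij] : exists j : 'I_2, i != j.
      by move: i {z}; apply: ord2P; [exists 1|exists 0].
    have := @indep i j 1 0 ij; rewrite z scaler0 scale0r => /(_ erefl)/eqP.
    by rewrite oner_eq0.
  have lin t : binary_group phi t -> scalable (rho t).
    by move=> _; apply/linear_scalable/natural_act_linear.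
  split.
  - by apply: one_dim_irrep_line => // t /inv [c ec]; exists c.
  - by apply: one_dim_irrep_line => // t /inv [c ec]; exists c.
  - by apply: rep_iso_lines => // t /inv [c ec]; exists c.
  - by apply: directv_lines => a b; apply: (indep 0 1).
move=> n k phi2 W rhoW U g _ h2 rho repW irrW hU _ rows _ fq.
apply: (lift_of_invariant_rows hphi hG hphi1 h2 _ fq) => t ht.
have [c hc] := isotypic_scalar repW irrW hU ht.
by exists c => i; apply/hc/rows.
Qed.
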